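(* Let $1\le p<2$ and let $X$ be a subspace of some $L_p$ space. Then $X$ embeds isomorphically into $L_p(\mu)$ for some finite measure $\mu$ if and only if $\ell_p(\aleph_1)$ does not embed isomorphically into $X$.
   Context: An $L_p$ space is a Banach space $L_p(\nu)$ with $\nu$ an arbitrary (not necessarily finite or $\sigma$-finite) measure. Subspaces are closed linear subspaces. A Banach space $Y$ embeds isomorphically into $Z$ if there is a bounded linear operator $Y\to Z$ that is an isomorphism onto its (closed) range. For a cardinal $\aleph$, $\ell_p(\aleph)$ denotes $\ell_p(\Gamma)$ for a set $\Gamma$ of cardinality $\aleph$. *)

(* Defs.v *)
From HB Require Import structures.
From mathcomp Require Import all_boot all_order all_algebra generic_quotient.
From mathcomp Require Import all_classical all_reals all_analysis.
From mathcomp Require Import measurable_realfun ess_sup_inf wochoice.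

Set Implicit Arguments.
Unset Strict Implicit.
Unset Printing Implicit Defensive.
Import Order.TTheory GRing.Theory Num.Theory.
Import numFieldNormedType.Exports.
Local Open Scope classical_set_scope.
Local Open Scope ring_scope.
Local Open Scope quotient_scope.

(* The library's [LspaceType mu p1] is the set of a.e.-equality classes of
   measurable functions with finite p-norm, without algebraic structure; here it
   receives its normed space structure, computed on representatives. *)
Section Lspace_normedModType.
Context d (T : measurableType d) (R : realType).
Variables (mu : {measure set T -> \bar R}) (p : \bar R) (p1 : (1 <= p)%E).
Local Notation Lp := (LspaceType mu p1).
Local Notation Lf := (LfunType mu p1).
Local Notation M := {mfun_ mu, T >-> measurableTypeR R}.

HB.instance Definition _ := gen_eqMixin Lp.
HB.instance Definition _ := gen_choiceMixin Lp.

Lemma ae_repr (f : {mfun T >-> measurableTypeR R}) :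
  (repr (\pi_M f) : T -> R) = (f : T -> R) %[ae mu].
Proof. by have /eqP := reprK (\pi_M f); rewrite eqmodE => /asboolP. Qed.

Lemma ae_eq_Lnorm (f g : T -> R) : measurable_fun setT f ->
  measurable_fun setT g -> f = g %[ae mu] ->
  ('N[mu]_p[EFin \o f] = 'N[mu]_p[EFin \o g])%E.
Proof.
move=> mf mg fg; rewrite unlock /Lnorm; case: p p1 => [r r1| |] //.
- have mN (h : T -> R) : measurable_fun setT h ->
      measurable_fun [set: T] ((fun x : T => (`|(EFin \o h) x| `^ r)%E) : T -> \bar R).
    move=> /measurable_EFinP mh; apply: (measurableT_comp (measurable_poweR r)).
    exact: measurableT_comp.
  congr poweR; apply: ge0_ae_eq_integral => //.
  + exact: mN.
  + exact: mN.
  + by move=> x _ ; rewrite lee_fin powR_ge0.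
  + by move=> x _ ; rewrite lee_fin powR_ge0.
  + by apply: filterS fg => x /= /(_ I) ->.
- by move=> _; case: ifPn => // _; apply: eq_ess_sup;
    apply: filterS fg => x /= /(_ I) ->.
Qed.

Definition Lrepr (u : Lp) : T -> R := repr (LebesgueSpace.sort u).

Lemma measurable_Lrepr u : measurable_fun setT (Lrepr u).
Proof. exact: (@measurable_funPT _ _ _ _ (repr (LebesgueSpace.sort u))). Qed.

Lemma Lrepr_Lfun (u : Lp) : Lrepr u \in Lfun mu p.
Proof.
apply/andP; split; rewrite inE /=; first exact: measurable_Lrepr.
exact: (@Lebesgue_finite _ _ _ _ _ p1 u).
Qed.

Definition Lfun_of (u : Lp) : Lf := Lfun_Sub p1 (Lrepr_Lfun u).

Definition mfun_of (f : Lf) : {mfun T >-> measurableTypeR R} :=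
  HB.pack_for {mfun T >-> measurableTypeR R} (f : T -> R)
    (@isMeasurableFun.Build _ _ T (measurableTypeR R) f
       (@measurable_funPT _ _ _ _ f)).

Lemma Lclass_subproof (f : Lf) :
  finite_norm mu p (repr (\pi_M (mfun_of f))).
Proof.
rewrite /finite_norm (@ae_eq_Lnorm _ f) //.
- exact: (@Lfunction_finite _ _ _ _ _ p1 f).
- exact: (@measurable_funPT _ _ _ _ (repr (\pi_M (mfun_of f)))).
- exact: (ae_repr (mfun_of f)).
Qed.

Definition Lclass (f : Lf) : Lp :=
  HB.pack_for Lp (\pi_M (mfun_of f))
    (@isFinLebesgue.Build _ _ _ mu p p1 _ (Lclass_subproof f)).

Lemma Lspace_inj (u v : Lp) :
  LebesgueSpace.sort u = LebesgueSpace.sort v -> u = v.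
Proof.
case: u v => [u [[hu]]] [v [[hv]]] /= uv; move: hu; rewrite uv => hu.
by rewrite (Prop_irrelevance hu hv).
Qed.

Lemma LclassP (f g : Lf) :
  Lclass f = Lclass g <-> (f : T -> R) = (g : T -> R) %[ae mu].
Proof.
split=> [[] /eqP|fg]; first by rewrite eqmodE => /asboolP.
by apply: Lspace_inj; apply/eqP; rewrite eqmodE; apply/asboolP.
Qed.

Lemma Lfun_ofK (u : Lp) : Lclass (Lfun_of u) = u.
Proof.
apply: Lspace_inj => /=; rewrite -[RHS]reprK; apply/eqP; rewrite eqmodE.
by apply/asboolP; exact: ae_eq_refl.
Qed.

Lemma LclassK (f : Lf) : (Lfun_of (Lclass f) : T -> R) = f %[ae mu].
Proof. by apply/LclassP; rewrite Lfun_ofK. Qed.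

Local Notation add u v := (Lclass (Lfun_of u + Lfun_of v)).
Local Notation opp u := (Lclass (- Lfun_of u)).
Local Notation scale a u := (Lclass (a *: Lfun_of u)).

Let add_Lclass (f g : Lf) : add (Lclass f) (Lclass g) = Lclass (f + g).
Proof.
apply/LclassP; apply: filterS2 (LclassK f) (LclassK g) => x /= fx gx _.
by rewrite /GRing.add /= fx// gx.
Qed.

Let opp_Lclass (f : Lf) : opp (Lclass f) = Lclass (- f).
Proof.
by apply/LclassP; apply: filterS (LclassK f) => x /= fx _; rewrite /GRing.opp /= fx.
Qed.

Let scale_Lclass a (f : Lf) : scale a (Lclass f) = Lclass (a *: f).
Proof.
by apply/LclassP; apply: filterS (LclassK f) => x /= fx _; rewrite /GRing.scale /= fx.
Qed.

Let LspaceE (u : Lp) : exists f, u = Lclass f.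
Proof. by exists (Lfun_of u); rewrite Lfun_ofK. Qed.

Let addA : associative (fun u v : Lp => add u v).
Proof.
move=> u v w; have [f ->] := LspaceE u; have [g ->] := LspaceE v; have [h ->] := LspaceE w.
by rewrite (add_Lclass g h) (add_Lclass f g) !add_Lclass addrA.
Qed.

Let addC : commutative (fun u v : Lp => add u v).
Proof. by move=> u v; rewrite addrC. Qed.

Let add0 : left_id (Lclass 0) (fun u v : Lp => add u v).
Proof. by move=> u; have [f ->] := LspaceE u; rewrite add_Lclass add0r. Qed.

Let addN : left_inverse (Lclass 0) (fun u : Lp => opp u) (fun u v : Lp => add u v).
Proof. by move=> u; have [f ->] := LspaceE u; rewrite (opp_Lclass f) add_Lclass addNr. Qed.

HB.instance Definition _ := GRing.isZmodule.Build Lp addA addC add0 addN.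

Let scaleA a b (u : Lp) : scale a (scale b u) = scale (a * b) u.
Proof. by have [f ->] := LspaceE u; rewrite (scale_Lclass b f) !scale_Lclass scalerA. Qed.

Let scale1 (u : Lp) : scale 1 u = u.
Proof. by have [f ->] := LspaceE u; rewrite !scale_Lclass scale1r. Qed.

Let scaleDr : right_distributive (fun a (u : Lp) => scale a u) +%R.
Proof.
move=> a u v; have [f ->] := LspaceE u; have [g ->] := LspaceE v.
by rewrite /GRing.add/= add_Lclass !scale_Lclass add_Lclass scalerDr.
Qed.

Let scaleDl (u : Lp) : {morph (fun a => scale a u : Lp) : a b / a + b}.
Proof.
move=> a b; have [f ->] := LspaceE u.
by rewrite [RHS]/GRing.add/= !scale_Lclass add_Lclass scalerDl.
Qed.

HB.instance Definition _ :=
  GRing.Zmodule_isLmodule.Build R Lp scaleA scale1 scaleDr scaleDl.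

Definition Lspace_norm (u : Lp) : R := fine 'N[mu]_p[EFin \o Lrepr u]%E.

Lemma Lspace_normE (f : Lf) :
  Lspace_norm (Lclass f) = fine 'N[mu]_p[EFin \o f]%E.
Proof.
congr fine; apply: ae_eq_Lnorm; last exact: LclassK.
  exact: measurable_Lrepr.
exact: (@measurable_funPT _ _ _ _ f).
Qed.

Let normD (u v : Lp) : Lspace_norm (u + v) <= Lspace_norm u + Lspace_norm v.
Proof.
rewrite /GRing.add/= Lspace_normE.
exact: (ler_LnormD (Lfun_of u) (Lfun_of v)).
Qed.

Let normZ a (u : Lp) : Lspace_norm (a *: u) = `|a| * Lspace_norm u.
Proof.
rewrite /GRing.scale/= Lspace_normE.
apply: EFin_inj; rewrite EFinM (finite_norm_fine (a *: Lfun_of u)).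
by rewrite (finite_norm_fine (Lfun_of u)); exact: LnormZ.
Qed.

Let norm0 (u : Lp) : Lspace_norm u = 0 -> u = 0.
Proof.
move=> u0; rewrite -(Lfun_ofK u); apply/LclassP.
by apply: filterS (@fine_Lnormr_eq0 _ _ _ _ _ p1 (Lfun_of u) u0) => x /= ux I; exact: ux.
Qed.

HB.instance Definition _ := Lmodule_isNormed.Build R Lp normD normZ norm0.

Lemma LclassD (f g : Lf) : Lclass (f + g) = Lclass f + Lclass g.
Proof. by rewrite [RHS]/GRing.add/= add_Lclass. Qed.

Lemma LclassZ (a : R) (f : Lf) : Lclass (a *: f) = a *: Lclass f.
Proof. by rewrite [RHS]/GRing.scale/= scale_Lclass. Qed.

Lemma norm_Lclass (f : Lf) : `|Lclass f| = fine 'N[mu]_p[EFin \o f]%E.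
Proof. exact: Lspace_normE. Qed.

End Lspace_normedModType.

Definition subspace_type (R : realType) (V : normedModType R)
  (X : submodClosed V) : Type := {v : V | v \in X}.

Section subspace_normedModType.
Context (R : realType) (V : normedModType R) (X : submodClosed V).
Local Notation S := (subspace_type X).

HB.instance Definition _ := SubType.on S.
HB.instance Definition _ := [Choice of S by <:].
HB.instance Definition _ := [SubChoice_isSubLmodule of S by <:].

Let norm (u : S) : R := `|val u|.

Let normD (u v : S) : norm (u + v) <= norm u + norm v.
Proof. exact: ler_normD. Qed.

Let normZ a (u : S) : norm (a *: u) = `|a| * norm u.
Proof. exact: normrZ. Qed.

Let norm0 (u : S) : norm u = 0 -> u = 0.
Proof. by move/normr0_eq0 => u0; apply: val_inj. Qed.

HB.instance Definition _ := Lmodule_isNormed.Build R S normD normZ norm0.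

End subspace_normedModType.

(* The second condition says that [f] is injective with bounded inverse on its
   range. *)
Definition isomorphic_embedding (R : realType) (Y Z : normedModType R)
    (f : {linear Y -> Z}) : Prop :=
  [/\ exists C : R, forall y, `|f y| <= C * `|y|,
      exists C : R, forall y, `|y| <= C * `|f y|
    & closed (range f)].

Definition embeds_isomorphically (R : realType) (Y Z : normedModType R) : Prop :=
  exists f : {linear Y -> Z}, isomorphic_embedding f.

(* [A] has the least uncountable cardinality. *)
Definition card_aleph1 (T : Type) (A : set T) : Prop :=
  ~ countable A /\ forall (U : Type) (B : set U), ~ countable B -> (A #<= B)%card.

Lemma uncountable_set_nat : ~ countable [set: set nat].
Proof.
move=> /countable_injP[f finj].
pose D : set nat := [set n | exists2 A, f A = n & ~ A n].
have nD : ~ D (f D).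
  move=> DD; case: (DD) => A fA; apply.
  by rewrite -fA; have -> : A = D by apply: finj; rewrite ?inE.
by apply: (nD); exists D.
Qed.

Lemma card_aleph1_exists : exists G : pointedType, card_aleph1 [set: G].
Proof.
pose T : choiceType := set nat.
have [le wo] := @well_ordering_principle T.
pose lt (x y : T) := le x y /\ x <> y.
have lemin (A : set T) x : A x -> exists2 m, A m & forall y, A y -> le m y.
  move=> Ax; have [|m [[/set_mem Am mA] _]] := wo (mem A).
    by exists x; rewrite inE.
  by exists m => // y Ay; apply: mA; rewrite inE.
have leP x y : le x y \/ le y x.
  have [m [->|->] h] := lemin [set x; y] x (or_introl erefl).
    by left; apply: h; right.
  by right; apply: h; left.
have lexx x : le x x by have [] := leP x x.
have leanti x y : le x y -> le y x -> x = y.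
  move=> xy yx; have [|m [_ mu]] := wo (mem [set x; y]).
    by exists x; rewrite inE; left.
  rewrite -(mu x) ?(mu y)//; split; rewrite ?inE; do ?[by left|by right];
  by move=> z; rewrite inE => -[]->.
have wf : well_founded lt.
  move=> x; apply: contrapT => nx.
  have [m nm mmin] := lemin [set y | ~ Acc lt y] x nx.
  apply: nm; constructor => y [ym yNm]; apply: contrapT => ny.
  by apply: yNm; apply: leanti => //; exact: mmin.
pose seg x := [set y | lt y x].
have [A uA segA] : exists2 A : set T, ~ countable A &
    forall x, A x -> countable [set y | A y /\ lt y x].
  have [[x ux]|nux] := pselect (exists x, ~ countable (seg x)); last first.
    exists setT; first exact: uncountable_set_nat.
    move=> x _; apply: contrapT => ux; apply: nux; exists x => cx; apply: ux.
    by apply: sub_countable cx; apply: subset_card_le => y [].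
  have [m um mmin] := lemin [set y | ~ countable (seg y)] x ux.
  exists (seg m) => // y [ym yNm]; apply: contrapT => uy.
  apply: yNm; apply: leanti => //; apply: mmin => cy; apply: uy.
  by apply: sub_countable cy; apply: subset_card_le => z [].
have [a0 Aa0] : exists a, A a.
  by apply: contrapT => nA; apply: uA; rewrite (_ : A = set0) ?countable0//
    -subset0 => x Ax; apply: nA; exists x.
pose S := {x : T | x \in A}.
pose s0 : S := exist _ a0 (mem_set Aa0).
pose G : pointedType := HB.pack_for pointedType S (isPointed.Build S s0).
exists G.
have AG : ([set: G] #= A)%card.
  rewrite (_ : A = val @` [set: G]); first by rewrite card_eq_sym inj_card_eq// => x y _ _ /val_inj.
  apply/seteqP; split=> [x Ax|_ [x _ <-]]; last exact: set_mem (valP x).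
  by exists (exist _ x (mem_set Ax)).
split=> [cG|U B uB].
  by apply: uA; rewrite -(eq_countable AG).
rewrite (card_le_eql AG).
have [u0 Bu0] : exists u, B u.
  by apply: contrapT => nB; apply: uB; rewrite (_ : B = set0) ?countable0//
    -subset0 => x Bx; apply: nB; exists x.
pose F (x : T) (rec : forall y, lt y x -> U) : U :=
  if pselect (exists u, B u /\ forall y (h : lt y x), A y -> rec y h <> u) is left e
  then projT1 (cid e) else u0.
pose f := Fix wf (fun=> U) F.
have fE x : f x = F x (fun y _ => f y).
  rewrite /f Fix_eq// => {}x g h gh; congr F.
  by apply/functional_extensionality_dep => y; apply/functional_extensionality_dep.
have fP x : A x -> B (f x) /\ forall y, lt y x -> A y -> f y <> f x.
  move=> Ax; rewrite fE /F; case: pselect => [e|ne]; last first.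
    exfalso; apply: uB; apply: (@sub_countable _ _ _ (f @` [set y | A y /\ lt y x])).
      apply: subset_card_le => u Bu; apply: contrapT => nu; apply: ne.
      by exists u; split=> // y yx Ay fyu; apply: nu; exists y.
    by apply: sub_countable (segA _ Ax); exact: card_image_le.
  by case: (cid e) => u [Bu hu] /=.
have finj : {in A &, injective f}.
  move=> x y /set_mem Ax /set_mem Ay fxy; apply: contrapT => xy.
  have [le_xy|le_yx] := leP x y.
    by apply: (fP y Ay).2 fxy.
  by apply: (fP x Ax).2 (esym fxy) => //; split=> // yx; apply: xy.
rewrite -(card_le_eql (inj_card_eq finj)); apply: subset_card_le => _ [x Ax <-].
exact: (fP x Ax).1.
Qed.

Section ell.
Context (R : realType) (p : \bar R) (p1 : (1 <= p)%E) (G : pointedType).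

(* [G] with all subsets measurable, so that L_p of the counting measure is
   ell_p(G); measurable types are pointed, hence so is [G]. *)
Definition discrete_type : Type := G.
HB.instance Definition _ := Pointed.on discrete_type.
HB.instance Definition _ := @isMeasurable.Build default_measure_display
  discrete_type discrete_measurable discrete_measurable0
  discrete_measurableC discrete_measurableU.

Definition ell : normedModType R :=
  LspaceType (counting : {measure set discrete_type -> \bar R}) p1.
End ell.

(* Main.v *)
(* Write [N u] for the [p]-th power of the norm.  For 1 <= p <= 2, with [grad u] the
   derivative of [N] at [u],
     N u + grad u x + N (x - x 1_A) <= N (u + x) <= N u + grad u x + 2 p N x
   whenever [u] vanishes outside [A].

   An uncountable [ell_p] does not embed for finite [mu]: uncountably many unit vectors
   are truncated at the same height up to a small error, and for suitable signs the
   bounded parts add up as in L_2 while the remainders add up as in [ell_p], so that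
   [N] of a signed sum of [n] images is too small for large [n].

   Conversely, let [X] have no embedding.  If every countable subset [s] of [X] admits
   [x] in [X] such that [grad u x = 0] for all [u] in the span of [s] and a fixed
   proportion of [x] lives outside the support of [s], then a maximal [ell_p]-like
   subset of [X] is uncountable, hence [ell_p(aleph_1)] embeds in [X].  If not, some
   countable [s] is such that the common kernel of the [grad u] in [X] is supported on
   the support of [s]; by uniform convexity (p > 1) a countable set of vectors of [X]
   realizes, up to closure, all values of these countably many functionals, so that
   [X] itself has a sigma-finite support and embeds after a change of density.  For
   p = 1 the kernel condition is unnecessary, since a proportion larger than one half
   suffices by the triangle inequality. *)
Require Import Defs.
From HB Require Import structures.
From mathcomp Require Import all_boot all_order all_algebra.
From mathcomp Require Import all_classical all_reals all_analysis.
From mathcomp Require Import measurable_realfun.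
From mathcomp Require Import ring lra.

Set Implicit Arguments.
Unset Strict Implicit.
Unset Printing Implicit Defensive.
Import Order.TTheory GRing.Theory Num.Theory.
Import numFieldNormedType.Exports.
Local Open Scope classical_set_scope.
Local Open Scope ring_scope.

(** * Pointwise inequalities *)

Section signed_power.
Context {R : realType}.
Implicit Types (p q x y s t a b : R).

(** For [q = p - 1], [p * spow q] is the derivative of [|x| ^ p]. The sign factor makes [spow 0] the
    sign function, with value 0 at 0 although [0 ^ 0 = 1]; this covers [p = 1]. *)
Definition spow q x : R := Num.sg x * `|x| `^ q.

Lemma spow0 q : spow q 0 = 0.
Proof. by rewrite /spow sgr0 mul0r. Qed.

Lemma spowN q x : spow q (- x) = - spow q x.
Proof. by rewrite /spow sgrN normrN mulNr. Qed.

Lemma spow_ge0 q x : 0 <= x -> spow q x = if x == 0 then 0 else x `^ q.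
Proof.
move=> x0; have [->|xN0] := eqVneq; first by rewrite spow0.
by rewrite /spow gtr0_sg ?lt0r ?xN0// mul1r gtr0_norm// lt0r xN0.
Qed.

Lemma spow_le_norm q x : `|spow q x| <= `|x| `^ q.
Proof.
rewrite /spow normrM normr_sg ger0_norm ?powR_ge0//.
by rewrite ler_piMl ?powR_ge0//; case: (x != 0).
Qed.

Lemma spow_mul p x : 0 < p -> spow (p - 1) x * x = `|x| `^ p.
Proof.
move=> p0; rewrite -(mulr_powRB1 _ p0)// /spow {3}[x]numEsg.
have [->|xN0] := eqVneq x 0; first by rewrite sgr0 normr0 !(mul0r, mulr0).
by rewrite mulrACA -expr2 sqr_sg xN0 mul1r mulrC.
Qed.

Lemma powRKV p x : p != 0 -> 0 <= x -> (x `^ p) `^ p^-1 = x.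
Proof. by move=> p0 x0; rewrite -powRrM mulfV// powRr1. Qed.

(** Young's inequality for [y] and [x ^ (p - 1)] with exponents [p] and [p / (p - 1)], multiplied by
    [p]; the case [p = 1], where the second exponent degenerates, is separate. *)
Lemma powR_young p x y : 1 <= p -> 0 <= x -> 0 <= y ->
  p * (x `^ (p - 1) * y) <= y `^ p + (p - 1) * x `^ p.
Proof.
rewrite le_eqVlt => /predU1P[<-|p1] x0 y0.
  by rewrite subrr powRr0 powRr1// mul0r addr0 !mul1r.
have p0 : 0 < p by rewrite (lt_trans _ p1).
have q0 : 0 < p / (p - 1) by rewrite divr_gt0// subr_gt0.
have pN0 : p - 1 != 0 by rewrite subr_eq0 gt_eqF.
have := @conjugate_powR _ y (x `^ (p - 1)) p (p / (p - 1)) y0 (powR_ge0 _ _) p0 q0.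
rewrite invf_div -powRrM (_ : (p - 1) * (p / (p - 1)) = p); last by field.
move=> H.
have {}H : y * x `^ (p - 1) <= y `^ p / p + x `^ p * ((p - 1) / p).
  by apply: H; field; rewrite gt_eqF.
rewrite (mulrC _ y) -ler_pdivlMl// (le_trans H)// le_eqVlt; apply/orP; left.
by apply/eqP; field; rewrite gt_eqF.
Qed.

(** A convex function lies above its tangents: after expansion with [spow_mul], Young's inequality
    for [|x|] and [|y|] remains. *)
Lemma powR_gradient p x y : 1 <= p ->
  `|x| `^ p + p * spow (p - 1) x * (y - x) <= `|y| `^ p.
Proof.
move=> p1; have p0 : 0 < p by rewrite (lt_le_trans _ p1).
rewrite (_ : p * spow (p - 1) x * (y - x) =
  p * (spow (p - 1) x * y) - p * (spow (p - 1) x * x)); last by ring.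
rewrite spow_mul//.
have := powR_young p1 (normr_ge0 x) (normr_ge0 y).
have : spow (p - 1) x * y <= `|x| `^ (p - 1) * `|y|.
  by rewrite (le_trans (ler_norm _))// normrM ler_wpM2r// spow_le_norm.
move=> /(ler_wpM2l (ltW p0)); lra.
Qed.

Lemma powR_subadd q x y : 0 <= q <= 1 -> 0 <= x -> 0 <= y ->
  (x + y) `^ q <= x `^ q + y `^ q.
Proof.
move=> /andP[q0 q1]; rewrite le_eqVlt => /predU1P[<-|x0].
  by rewrite add0r => y0; rewrite lerDr powR_ge0.
rewrite le_eqVlt => /predU1P[<-|y0]; first by rewrite addr0 lerDl powR_ge0.
have xy0 : 0 < x + y by rewrite addr_gt0.
have xyN0 : x + y != 0 by rewrite gt_eqF.
(* A ratio [z / (x + y)] in (0, 1] does not decrease when raised to the power [q <= 1]; the two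
   ratios add up to 1. *)
have h z : 0 < z -> z <= x + y -> z / (x + y) * (x + y) `^ q <= z `^ q.
  move=> z0 zxy.
  rewrite -[in leRHS](divfK xyN0 z) powRM ?divr_ge0 ?(ltW z0) ?(ltW xy0)//.
  rewrite ler_wpM2r ?powR_ge0// ger1_powR// divr_gt0//=.
  by rewrite ler_pdivrMr// mul1r.
have := lerD (h x x0 _) (h y y0 _); rewrite lerDl lerDr => /(_ (ltW _) (ltW _)).
rewrite -mulrDl -mulrDl divff ?gt_eqF// mul1r; exact.
Qed.

(** For equal signs this is subadditivity, with constant 1; for opposite signs both [|s|] and [|t|]
    are at most [|s - t|], whence the factor 2. *)
Lemma spow_holder q s t : 0 <= q <= 1 ->
  `|spow q s - spow q t| <= 2 * `|s - t| `^ q.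
Proof.
move=> /[dup] q01 /andP[q0 q1].
wlog s0 : s t / 0 <= s.
  move=> H; have [s0|s0] := leP 0 s; first exact: H.
  have := H (- s) (- t); rewrite !spowN oppr_ge0 (ltW s0) -!opprD !normrN; exact.
wlog ts : s t s0 / t <= s.
  move=> H; have [ts|st] := leP t s; first exact: H.
  by rewrite distrC (distrC s) H ?(ltW st)// (le_trans s0)// ltW.
have ler_pow a b : 0 <= a -> a <= b -> a `^ q <= b `^ q.
  by move=> a0 ab; rewrite ge0_ler_powR// nnegrE// (le_trans a0).
have st0 : 0 <= s - t by rewrite subr_ge0.
rewrite (ger0_norm st0).
have [t0|t0] := leP 0 t; last first.
  rewrite (le_trans (ler_normB _ _))// mulrDl !mul1r lerD//.
    by rewrite (le_trans (spow_le_norm _ _))// ger0_norm// ler_pow// lerDl oppr_ge0 ltW.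
  rewrite (le_trans (spow_le_norm _ _))// ltr0_norm// ler_pow ?oppr_ge0 ?(ltW t0)//.
  by rewrite lerDr.
suff : `|spow q s - spow q t| <= (s - t) `^ q.
  by move=> /le_trans; apply; rewrite ler_peMl ?powR_ge0// ler1n.
move: t0; rewrite le_eqVlt => /predU1P[<-|t0].
  by rewrite spow0 !subr0 (le_trans (spow_le_norm _ _))// ger0_norm.
have s0' : 0 < s by rewrite (lt_le_trans t0).
rewrite !spow_ge0 ?(ltW t0)// !gt_eqF// ger0_norm ?subr_ge0 ?ler_pow ?(ltW t0)//.
by rewrite lerBlDr -[in leLHS](subrK t s) powR_subadd// ltW.
Qed.

(* The gradient inequality at [x + y] bounds the increment of [|x|^p] by the
   derivative at [x + y], which the Hoelder continuity of [spow] moves to [x]. *)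
Lemma powR_smooth p x y : 1 <= p <= 2 ->
  `|x + y| `^ p <= `|x| `^ p + p * spow (p - 1) x * y + 2 * p * `|y| `^ p.
Proof.
move=> /andP[p1 p2]; have p0 : 0 < p by rewrite (lt_le_trans _ p1).
have := powR_gradient (x + y) x p1.
have q01 : 0 <= p - 1 <= 1 by rewrite subr_ge0 p1/= lerBlDr.
have := spow_holder (x + y) x q01; rewrite addrAC subrr add0r => H.
have : (spow (p - 1) (x + y) - spow (p - 1) x) * y <= 2 * `|y| `^ p.
  rewrite (le_trans (ler_norm _))// normrM -(mulr_powRB1 _ p0)//.
  by rewrite [`|y| * _]mulrC mulrA ler_wpM2r.
move=> /(ler_wpM2l (ltW p0)); lra.
Qed.

(** By concavity the power lies below its tangent at [s], which is Young's inequality for the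
    exponent [1 / q]; the slope [q * s ^ (q - 1)] is at least [q] because [s <= 1]. *)
Lemma powR_diff_lower q s t : 0 < q <= 1 -> 0 <= t -> t <= s -> s <= 1 ->
  q * (s - t) <= s `^ q - t `^ q.
Proof.
move=> /andP[q0 q1] t0; rewrite le_eqVlt => /predU1P[->|ts] s1.
  by rewrite !subrr mulr0.
have s0 : 0 < s by rewrite (le_lt_trans t0).
have hs : 1 <= s `^ (q - 1).
  by rewrite -[leLHS](powRr0 s) ger_powR ?s0// subr_le0.
suff : t `^ q <= s `^ (q - 1) * (q * t + (1 - q) * s).
  have E : s `^ (q - 1) * s = s `^ q by rewrite mulrC mulr_powRB1 ?(ltW s0).
  rewrite -E.
  have : q * (s - t) <= s `^ (q - 1) * (q * (s - t)).
    by rewrite ler_peMl// mulr_ge0 ?subr_ge0 ?(ltW q0) ?(ltW ts).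
  move: (s `^ (q - 1)) => S; rewrite !(mulrDr, mulrBr) => h1 h2.
  lra.
have qN0 : q != 0 by rewrite gt_eqF.
have qi1 : 1 <= q^-1 by rewrite invf_ge1.
have := powR_young qi1 (powR_ge0 s q) (powR_ge0 t q).
rewrite -!powRrM mulfV// (_ : q * (q^-1 - 1) = 1 - q); last by field.
rewrite !powRr1// ?(ltW s0)// ler_pdivrMl// => H.
have {}H : s `^ (1 - q) * t `^ q <= q * t + (1 - q) * s.
  by apply: (le_trans H); rewrite le_eqVlt; apply/orP; left; apply/eqP; field.
have := ler_wpM2l (powR_ge0 s (q - 1)) H; rewrite mulrA -powRD; last by rewrite (gt_eqF s0) implybT.
by rewrite addrA subrK subrr powRr0 mul1r.
Qed.

Lemma spow_diff_lower q s t : 0 < q <= 1 -> t <= s -> -1 <= t -> s <= 1 ->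
  q * (s - t) <= spow q s - spow q t.
Proof.
move=> q01 ts t1 s1; have /andP[q0 q1] := q01.
have spowE x : 0 <= x -> spow q x = x `^ q.
  by move=> x0; rewrite spow_ge0//; case: eqVneq => // ->; rewrite powR0// gt_eqF.
have spowNE x : spow q x = - spow q (- x) by rewrite spowN opprK.
have [t0|t0] := leP 0 t.
  by rewrite !spowE ?(le_trans t0)// powR_diff_lower.
have [s0|s0] := leP s 0.
  rewrite (spowNE s) (spowNE t) !spowE ?oppr_ge0// ?(ltW t0)//.
  have s0' : 0 <= - s by rewrite oppr_ge0.
  have ts' : - s <= - t by rewrite lerN2.
  have t1' : - t <= 1 by rewrite lerNl.
  by have := powR_diff_lower q01 s0' ts' t1'; lra.
rewrite (spowNE t) !spowE ?oppr_ge0// ?(ltW t0)// ?(ltW s0)//.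
have := @powR_diff_lower q s 0 q01 (lexx _) (ltW s0) s1.
have := @powR_diff_lower q (- t) 0 q01 (lexx _).
rewrite oppr_ge0 (ltW t0) lerNl t1 powR0 ?gt_eqF// => /(_ isT isT).
by lra.
Qed.

(* Two gradient steps, from [m] to the midpoint [n] of [m] and [a] and from [n] to
   [a], gain the increment of [spow] over the first step. *)
Lemma powR_strong_gradient p a m : 1 < p <= 2 -> `|a| <= 1 -> `|m| <= 1 ->
  `|m| `^ p + p * spow (p - 1) m * (a - m) + p * (p - 1) / 4 * (a - m) ^+ 2
    <= `|a| `^ p.
Proof.
move=> /andP[p1 p2] a1 m1; have p0 : 0 < p by rewrite (lt_trans _ p1).
set n := (a + m) / 2.
have H1 := powR_gradient n a (ltW p1).
have H2 := powR_gradient m n (ltW p1).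
have q01 : 0 < p - 1 <= 1 by rewrite subr_gt0 p1/= lerBlDr.
have := a1; rewrite ler_norml => /andP[a1l a1r].
have := m1; rewrite ler_norml => /andP[m1l m1r].
have H3 : (p - 1) * (n - m) * (n - m) <= (spow (p - 1) n - spow (p - 1) m) * (n - m).
  have [mn|nm] := leP m n.
    rewrite ler_wpM2r ?subr_ge0// spow_diff_lower// /n; lra.
  rewrite ler_wnM2r ?subr_le0 ?(ltW nm)// -lerN2 !opprB -mulrN opprB.
  by rewrite spow_diff_lower ?(ltW nm)// /n; lra.
have {}H3 := ler_wpM2l (ltW p0) H3.
have an : a - n = n - m by rewrite /n; field.
have am : a - m = 2 * (n - m) by rewrite /n; field.
move: H1; rewrite an; rewrite am => H1.
rewrite (_ : _ / 4 * _ = p * ((p - 1) * (n - m) * (n - m))); last by field.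
move: H1 H2 H3.
set A := p * ((p - 1) * (n - m) * (n - m)).
move: (spow _ m) (spow _ n) (n - m) => sm sn e; lra.
Qed.

(** Average [powR_strong_gradient] from the midpoint [m] to [a] and to [b]: the linear terms cancel,
    and [(a - m) ^ 2 = (a - b) ^ 2 / 4]. *)
Lemma powR_unif_convex_unit p a b : 1 < p <= 2 -> `|a| <= 1 -> `|b| <= 1 ->
  p * (p - 1) / 16 * (a - b) ^+ 2 <=
    (`|a| `^ p + `|b| `^ p) / 2 - `|(a + b) / 2| `^ p.
Proof.
move=> p12 a1 b1; set m := (a + b) / 2.
have m1 : `|m| <= 1.
  rewrite /m normrM (ger0_norm (_ : 0 <= 2^-1))// ler_pdivrMr// mul1r.
  by rewrite (le_trans (ler_normD _ _))// lerD.
have := powR_strong_gradient p12 a1 m1; have := powR_strong_gradient p12 b1 m1.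
have -> : b - m = - (a - m) by rewrite /m; field.
rewrite sqrrN.
have -> : p * (p - 1) / 16 * (a - b) ^+ 2 = p * (p - 1) / 4 * (a - m) ^+ 2.
  by rewrite /m; field.
lra.
Qed.

(* If [|a - b|] is small relative to [M = max |a| |b|], the first term suffices;
   otherwise [|a - b|^p] and [(a - b)^2 M^(p - 2)] are comparable. *)
Lemma powR_unif_convex p e : 1 < p <= 2 -> 0 < e ->
  exists2 C : R, 0 < C & forall a b, `|a - b| `^ p <= e * (`|a| `^ p + `|b| `^ p) +
    C * ((`|a| `^ p + `|b| `^ p) / 2 - `|(a + b) / 2| `^ p).
Proof.
move=> p12 e0; have /andP[p1 p2] := p12; have p0 : 0 < p by rewrite (lt_trans _ p1).
have pN0 : p != 0 by rewrite gt_eqF.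
pose n := e `^ p^-1; have n0 : 0 < n by rewrite powR_gt0.
pose c := p * (p - 1) / 16; have c0 : 0 < c.
  by rewrite /c divr_gt0// mulr_gt0// subr_gt0.
(* After scaling to [M = 1], if [|a - b| > n] then [|a - b| ^ p <= 2 ^ p], while the convexity gap
   is at least [c * n ^ 2]. *)
pose C := 2 `^ p / (n ^+ 2 * c); have C0 : 0 < C.
  by rewrite /C divr_gt0 ?powR_gt0// mulr_gt0// exprn_gt0.
exists C => //.
have unit a b : `|a| <= 1 -> `|b| <= 1 -> 1 <= `|a| `^ p + `|b| `^ p ->
    `|a - b| `^ p <= e * (`|a| `^ p + `|b| `^ p) +
      C * ((`|a| `^ p + `|b| `^ p) / 2 - `|(a + b) / 2| `^ p).
  move=> a1 b1 ab1; have U := powR_unif_convex_unit p12 a1 b1.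
  have U0 : 0 <= p * (p - 1) / 16 * (a - b) ^+ 2 by rewrite mulr_ge0 ?sqr_ge0// ltW.
  have [small|big] := leP `|a - b| n.
    rewrite (@le_trans _ _ e)//.
      rewrite -[leRHS]powRr1 ?(ltW e0)// -(mulVf pN0) powRrM.
      by rewrite ge0_ler_powR ?nnegrE ?powR_ge0// ltW.
    rewrite (@le_trans _ _ (e * (`|a| `^ p + `|b| `^ p)))//.
      by rewrite ler_peMr// ltW.
    by rewrite lerDl mulr_ge0 ?(ltW C0)// (le_trans U0).
  rewrite (@le_trans _ _ (C * (c * (a - b) ^+ 2)))//; last first.
    rewrite (@le_trans _ _ (C * ((`|a| `^ p + `|b| `^ p) / 2 - `|(a + b) / 2| `^ p)))//.
      by rewrite ler_pM2l.
    by rewrite lerDr mulr_ge0 ?(ltW e0)// addr_ge0 ?powR_ge0.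
  have -> : C * (c * (a - b) ^+ 2) = 2 `^ p * ((a - b) ^+ 2 / n ^+ 2).
    by rewrite /C; field; rewrite !gt_eqF.
  rewrite (@le_trans _ _ (2 `^ p))//.
    rewrite ge0_ler_powR ?nnegrE ?(ltW p0)//.
    by rewrite (le_trans (ler_normB _ _))// [leRHS](_ : _ = 1 + 1)// lerD.
  rewrite ler_peMr ?powR_ge0// ler_pdivlMr ?exprn_gt0// mul1r.
  by rewrite -(real_normK (num_real (a - b))) lerXn2r ?nnegrE ?(ltW n0) ?(ltW big).
move=> a b; pose M := Num.max `|a| `|b|.
have : 0 <= M by rewrite /M le_max normr_ge0.
rewrite le_eqVlt => /predU1P[M0|M0].
  have aM : `|a| <= 0 by rewrite M0 /M le_max lexx.
  have bM : `|b| <= 0 by rewrite M0 /M le_max lexx orbT.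
  have /eqP -> : a == 0 by rewrite -normr_le0.
  have /eqP -> : b == 0 by rewrite -normr_le0.
  by rewrite subrr addr0 mul0r normr0 powR0 ?gt_eqF// addr0 !mul0r subr0 !mulr0 addr0.
have aM : `|a / M| <= 1.
  by rewrite normrM normfV (gtr0_norm M0) ler_pdivrMr// mul1r /M le_max lexx.
have bM : `|b / M| <= 1.
  by rewrite normrM normfV (gtr0_norm M0) ler_pdivrMr// mul1r /M le_max lexx orbT.
have sc z : `|z / M| `^ p = `|z| `^ p * (M^-1 `^ p).
  by rewrite normrM normfV (gtr0_norm M0) powRM ?invr_ge0 ?(ltW M0).
have Mp : 0 < M^-1 `^ p by rewrite powR_gt0 ?invr_gt0.
have abM : 1 <= `|a / M| `^ p + `|b / M| `^ p.
  have eq1 z : `|z| = M -> `|z / M| `^ p = 1.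
    move=> zM; rewrite normrM normfV (gtr0_norm M0) zM divff ?gt_eqF//.
    by rewrite powR1.
  have [ab|ba] := leP `|a| `|b|.
    rewrite (eq1 b) ?lerDr ?powR_ge0// /M.
    by apply/esym/max_idPr.
  by rewrite (eq1 a) ?lerDl ?powR_ge0// /M; apply/esym/max_idPl/ltW.
have := unit _ _ aM bM abM; rewrite -mulrBl -mulrDl (mulrAC (a + b)) !sc.
move=> H; rewrite -(ler_pM2r Mp) (le_trans H)// le_eqVlt; apply/orP; left.
by apply/eqP; field.
Qed.

(* Truncation: where [|x| <= L] use a constant, elsewhere [|x|^p <= L^(p-2) x^2]. *)
Lemma powR_le_sqr p s : 0 < p < 2 -> 0 < s ->
  exists2 C : R, 0 <= C & forall x, `|x| `^ p <= s * x ^+ 2 + C.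
Proof.
(* [L] solves [L ^ (p - 2) = s]. *)
move=> /andP[p0 p2] s0; pose L := s `^ (p - 2)^-1.
have L0 : 0 < L by rewrite powR_gt0.
exists (L `^ p) => [|x]; first exact: powR_ge0.
have [xL|Lx] := leP `|x| L.
  rewrite (@le_trans _ _ (L `^ p))//.
    by rewrite ge0_ler_powR ?nnegrE// ltW.
  by rewrite lerDr mulr_ge0 ?sqr_ge0// ltW.
have x0 : 0 < `|x| by rewrite (lt_trans L0).
rewrite (@le_trans _ _ (s * x ^+ 2))//; last by rewrite lerDl powR_ge0.
rewrite -(real_normK (num_real x)) -(powR_mulrn 2 (normr_ge0 x)).
rewrite -ler_pdivrMr ?powR_gt0// -powRB; last by rewrite (gt_eqF x0) implybT.
have -> : s = L `^ (p - 2).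
  by rewrite /L -powRrM mulVf ?powRr1 ?(ltW s0)// subr_eq0 lt_eqF.
rewrite -(opprB 2 p) !powRN lef_pV2 ?posrE ?powR_gt0//.
by rewrite ge0_ler_powR ?nnegrE ?subr_ge0 ?(ltW p2) ?(ltW L0) ?(ltW Lx).
Qed.

End signed_power.

(** * Gradient and convexity of the norm *)

Lemma linear_packed (R : realType) (U V : lmodType R) (f : U -> V) :
  linear f -> exists g : {linear U -> V}, forall x, g x = f x.
Proof.
move=> lf; pose F := GRing.isLinear.Build R U V *:%R f lf.
by exists (HB.pack_for {linear U -> V} f F).
Qed.

Section Lspace_pnorm.
Context d (T : measurableType d) (R : realType).
Variables (mu : {measure set T -> \bar R}) (p : R) (p1 : (1 <= p%:E)%E).
Local Notation Lp := (LspaceType mu p1).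
Local Notation Lf := (LfunType mu p1).

Let p1' : 1 <= p. Proof. by rewrite -lee_fin. Qed.
Let p0 : 0 < p. Proof. by rewrite (lt_le_trans _ p1'). Qed.

Lemma measurable_norm_powR (f : T -> R) : measurable_fun setT f ->
  measurable_fun setT (fun x => `|f x| `^ p).
Proof.
by move=> mf; apply: (measurableT_comp (measurable_powR _)); exact: measurableT_comp.
Qed.

Lemma measurable_Lfun (f : Lf) : measurable_fun setT f.
Proof. exact: measurable_funPT. Qed.

Lemma normp_Lclass_EFin (f : Lf) :
  (`|Lclass f| `^ p)%:E = (\int[mu]_x (`|f x| `^ p)%:E)%E.
Proof.
by rewrite norm_Lclass -poweR_EFin finite_norm_fine powR_Lnorm// gt_eqF.
Qed.

Lemma integrable_Lfun (f : Lf) :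
  mu.-integrable setT (EFin \o (fun x => `|f x| `^ p)).
Proof. exact/Lfun_integrable/LfunP. Qed.

Lemma normp_Lclass (f : Lf) : `|Lclass f| `^ p = \int[mu]_x (`|f x| `^ p).
Proof. by rewrite /Rintegral -normp_Lclass_EFin. Qed.

Lemma mem_Lfun (f : T -> R) : measurable_fun setT f ->
  (\int[mu]_x (`|f x| `^ p)%:E < +oo)%E -> f \in Lfun mu p%:E.
Proof.
move=> mf fi; apply/andP; split; rewrite inE//= /finite_norm.
by rewrite unlock poweR_lty.
Qed.

Lemma LclassB (f g : Lf) : Lclass (f - g) = Lclass f - Lclass g.
Proof. by rewrite -[in RHS]scaleN1r -LclassZ -LclassD scaleN1r. Qed.

Lemma normp_ge0 (u : Lp) : 0 <= `|u| `^ p. Proof. exact: powR_ge0. Qed.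

Lemma normp_eq0 (u : Lp) : `|u| `^ p <= 0 -> u = 0.
Proof.
move=> u0; have /eqP : `|u| `^ p = 0 by apply/eqP; rewrite eq_le u0 powR_ge0.
by rewrite powR_eq0 normr_eq0 => /andP[/eqP].
Qed.

Lemma Lfun_dominated (f : T -> R) (g h : Lf) : measurable_fun setT f ->
  (forall x, `|f x| <= `|g x| `^ p + `|h x| `^ p) ->
  mu.-integrable setT (EFin \o f).
Proof.
move=> mf fgh.
apply: (@le_integrable _ _ _ _ _ _ _ (EFin \o (fun x => `|g x| `^ p + `|h x| `^ p))) => //.
- exact/measurable_EFinP.
- by move=> x _; rewrite /= lee_fin [leRHS]ger0_norm ?addr_ge0 ?powR_ge0.
- exact: (integrableD measurableT (integrable_Lfun g) (integrable_Lfun h)).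
Qed.

(* The derivative of [|u|^p / p] at [f] in the direction [g]. *)
Definition Lgrad (f g : Lf) : R := \int[mu]_x (spow (p - 1) (f x) * g x).

Lemma measurable_spow q : measurable_fun [set: R] (@spow R q).
Proof.
rewrite /spow; apply: measurable_funM; last first.
  by apply: (measurableT_comp (measurable_powR _)); exact: normr_measurable.
have -> : (@Num.sg R) = (fun x => \1_`]0, +oo[ x - \1_`]-oo, 0[ x).
  apply/funext => x; rewrite !indicE !mem_setE !in_itv/= andbT.
  by case: sgrP => // _; rewrite ?subr0 ?sub0r.
by apply: measurable_funB; exact: measurable_indic.
Qed.

(** The product is at most the [p]-th power of the larger of [|x|] and [|y|]. This crude bound
    serves instead of Hoelder's inequality for the integrability of the gradient. *)
Lemma spow_mul_le (x y : R) : `|spow (p - 1) x * y| <= `|x| `^ p + `|y| `^ p.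
Proof.
have H : `|spow (p - 1) x * y| <= `|x| `^ (p - 1) * `|y|.
  by rewrite normrM ler_wpM2r// spow_le_norm.
apply: (le_trans H).
have [xy|yx] := leP `|x| `|y|.
  rewrite ler_wpDl ?powR_ge0// -(mulr_powRB1 (normr_ge0 y) p0) mulrC.
  by rewrite ler_wpM2l// ge0_ler_powR// ?nnegrE// subr_ge0.
rewrite ler_wpDr ?powR_ge0// -(mulr_powRB1 (normr_ge0 x) p0) mulrC.
by rewrite ler_wpM2r ?powR_ge0// ltW.
Qed.

Lemma integrable_Lgrad (f g : Lf) :
  mu.-integrable setT (EFin \o (fun x => spow (p - 1) (f x) * g x)).
Proof.
apply: (@Lfun_dominated _ f g); last by move=> x; exact: spow_mul_le.
apply: measurable_funM; last exact: measurable_Lfun.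
exact: (measurableT_comp (measurable_spow _) (measurable_Lfun _)).
Qed.

Lemma eq_Lgrad (f f' g g' : Lf) : Lclass f = Lclass f' -> Lclass g = Lclass g' ->
  Lgrad f g = Lgrad f' g'.
Proof.
move=> /LclassP ff' /LclassP gg'; congr fine.
apply: ae_eq_integral => //; [by case/integrableP: (integrable_Lgrad f g)|
  by case/integrableP: (integrable_Lgrad f' g')|].
by apply: filterS2 ff' gg' => x /= fx gx _; rewrite fx// gx.
Qed.

Lemma LgradP (f : Lf) a (g h : Lf) : Lgrad f (a *: g + h) = a * Lgrad f g + Lgrad f h.
Proof.
have I := integrable_Lgrad f.
rewrite /Lgrad -RintegralZl// -RintegralD//.
- by apply: eq_Rintegral => x _ /=; rewrite mulrDr mulrCA.
- exact: (integrableZl measurableT a (I g)).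
Qed.

Definition grad (u x : Lp) : R := p * Lgrad (Lfun_of u) (Lfun_of x).

Lemma gradE (f g : Lf) : grad (Lclass f) (Lclass g) = p * Lgrad f g.
Proof. by congr (_ * _); apply: eq_Lgrad; rewrite Lfun_ofK. Qed.

Lemma grad_linear u a x y : grad u (a *: x + y) = a * grad u x + grad u y.
Proof.
rewrite -[u in LHS]Lfun_ofK -[x in LHS]Lfun_ofK -[y in LHS]Lfun_ofK.
by rewrite -LclassZ -LclassD gradE LgradP /grad; ring.
Qed.

Lemma grad_bounded u x : `|grad u x| <= p * (`|u| `^ p + `|x| `^ p).
Proof.
rewrite /grad normrM (gtr0_norm p0) ler_pM2l//.
rewrite -[u in leRHS]Lfun_ofK -[x in leRHS]Lfun_ofK !normp_Lclass.
set f := Lfun_of u; set g := Lfun_of x.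
rewrite (le_trans (le_normr_Rintegral _ (integrable_Lgrad f g)))//.
rewrite -RintegralD//; try exact: integrable_Lfun.
apply: le_Rintegral => //; last by move=> t _; exact: spow_mul_le.
- exact: (integrable_abse (integrable_Lgrad f g)).
- exact: (integrableD measurableT (integrable_Lfun f) (integrable_Lfun g)).
Qed.

Lemma normp_smooth u x : p <= 2 ->
  `|u + x| `^ p <= `|u| `^ p + grad u x + 2 * p * `|x| `^ p.
Proof.
move=> p2; rewrite -[u]Lfun_ofK -[x]Lfun_ofK gradE -LclassD !normp_Lclass.
set f := Lfun_of u; set g := Lfun_of x.
have If := integrable_Lfun f; have Ig := integrable_Lfun g.
have Ifg := integrable_Lgrad f g.
have I1 : mu.-integrable setT (EFin \o (fun x => p * (spow (p - 1) (f x) * g x))).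
  exact: (integrableZl measurableT p Ifg).
have I2 : mu.-integrable setT (EFin \o (fun x => 2 * p * `|g x| `^ p)).
  exact: (integrableZl measurableT (2 * p) Ig).
have I3 : mu.-integrable setT
    (EFin \o (fun x => `|f x| `^ p + p * (spow (p - 1) (f x) * g x))).
  exact: (integrableD measurableT If I1).
rewrite /Lgrad -!RintegralZl// -!RintegralD//; apply: le_Rintegral => //.
- exact: integrable_Lfun.
- exact: (integrableD measurableT I3 I2).
- by move=> t _; rewrite mulrA; apply: powR_smooth; rewrite p1'.
Qed.

Lemma normp_unif_convex e : 1 < p <= 2 -> 0 < e ->
  exists2 C : R, 0 < C & forall x y : Lp, `|x - y| `^ p <=
    e * (`|x| `^ p + `|y| `^ p) +
    C * ((`|x| `^ p + `|y| `^ p) / 2 - `|2^-1 *: (x + y)| `^ p).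
Proof.
move=> p12 e0; have [C C0 H] := powR_unif_convex p12 e0; exists C => // x y.
rewrite -[x]Lfun_ofK -[y]Lfun_ofK -LclassD -LclassB -LclassZ !normp_Lclass.
set f := Lfun_of x; set g := Lfun_of y.
have If := integrable_Lfun f; have Ig := integrable_Lfun g.
have Is : mu.-integrable setT (EFin \o (fun x => `|f x| `^ p + `|g x| `^ p)).
  exact: (integrableD measurableT If Ig).
have Im := integrable_Lfun (2^-1 *: (f + g)).
have I1 : mu.-integrable setT (EFin \o (fun x => e * (`|f x| `^ p + `|g x| `^ p))).
  exact: (integrableZl measurableT e Is).
have I2 : mu.-integrable setT (EFin \o (fun x => (`|f x| `^ p + `|g x| `^ p) / 2)).
  exact: (integrableZr measurableT 2^-1 Is).
have I3 : mu.-integrable setT (EFin \o (fun x => (`|f x| `^ p + `|g x| `^ p) / 2 -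
    `|(2^-1 *: (f + g)) x| `^ p)).
  exact: (integrableB measurableT I2 Im).
have I4 : mu.-integrable setT (EFin \o (fun x => C * ((`|f x| `^ p + `|g x| `^ p) / 2 -
    `|(2^-1 *: (f + g)) x| `^ p))).
  exact: (integrableZl measurableT C I3).
rewrite -RintegralD// -RintegralZl// -RintegralZr// -RintegralB// -RintegralZl//.
rewrite -RintegralD//; apply: le_Rintegral => //.
- exact: integrable_Lfun.
- exact: (integrableD measurableT I1 I4).
- move=> t _; have -> : (2^-1 *: (f + g)) t = (f t + g t) / 2.
    by rewrite [RHS]mulrC.
  exact: H.
Qed.

End Lspace_pnorm.

(** * Completeness *)

Lemma geometric_small (R : realType) (c e : R) : 0 <= c -> 0 < e ->
  exists k, forall m, (k <= m)%N -> c / 2 ^+ m < e.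
Proof.
move=> c0 e0; exists (Num.truncn (c / e)).+1 => m km.
have ln : c / e < (Num.truncn (c / e)).+1%:R by exact: truncnS_gt.
rewrite ltr_pdivrMr ?exprn_gt0//.
move: ln; rewrite ltr_pdivrMr// => /lt_le_trans; apply.
rewrite mulrC ler_pM2l// -natrX ler_nat (leq_trans km)//.
by rewrite ltnW// ltn_expl.
Qed.

(** Nested intervals: every [x k - 2 * c / 2 ^ k] is below every [x m + 2 * c / 2 ^ m], so the
    supremum of the lower ends lies in all the intervals. *)
Lemma geometric_cauchy (R : realType) (x : nat -> R) (c : R) :
  (forall k, `|x k.+1 - x k| <= c / 2 ^+ k) ->
  exists2 l : R, x @ \oo --> l & forall k, `|l - x k| <= 2 * c / 2 ^+ k.
Proof.
move=> xc.
have c0 : 0 <= c by have := xc 0%N; rewrite expr0 divr1; exact: le_trans.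
have xkm k m : `|x (k + m)%N - x k| <= 2 * c / 2 ^+ k - 2 * c / 2 ^+ (k + m).
  elim: m => [|m ih]; first by rewrite addn0 !subrr normr0.
  rewrite addnS -[_ - x k](subrKA (x (k + m)%N)) (le_trans (ler_normD _ _))//.
  have := xc (k + m)%N => H.
  rewrite (le_trans (lerD H ih))// le_eqVlt; apply/orP; left; apply/eqP.
  rewrite exprS; have : (2 : R) ^+ (k + m) != 0 by rewrite expf_neq0.
  have : (2 : R) ^+ k != 0 by rewrite expf_neq0.
  by move: (2 ^+ (k + m)) (2 ^+ k) => a b a0 b0; field; rewrite a0 b0.
have pos k : 0 <= 2 * c / 2 ^+ k by rewrite divr_ge0 ?mulr_ge0.
have yz k m : x k - 2 * c / 2 ^+ k <= x m + 2 * c / 2 ^+ m.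
  have [km|mk] := leqP k m.
    have := xkm k (m - k)%N; rewrite subnKC// ler_norml => /andP[+ _].
    by have := pos m; lra.
  have := xkm m (k - m)%N; rewrite subnKC 1?ltnW// ler_norml => /andP[_ +].
  by have := pos k; lra.
pose A := range (fun k => x k - 2 * c / 2 ^+ k).
have A0 : A !=set0 by exists (x 0%N - 2 * c / 2 ^+ 0), 0%N.
have hA : has_sup A by split=> //; exists (x 0%N + 2 * c / 2 ^+ 0) => _ [k _ <-].
have lx k : `|sup A - x k| <= 2 * c / 2 ^+ k.
  rewrite ler_norml; apply/andP; split.
    have : x k - 2 * c / 2 ^+ k <= sup A by apply: sup_upper_bound => //; exists k.
    by lra.
  have : sup A <= x k + 2 * c / 2 ^+ k by apply: ge_sup => // _ [m _ <-].
  by lra.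
exists (sup A) => //; apply/cvgrPdist_le => e e0.
have [N Ne] := @geometric_small _ (2 * c) e (mulr_ge0 (ler0n _ _) c0) e0.
by exists N => // m /= Nm; rewrite (le_trans (lx m))// ltW// Ne.
Qed.

Section Lspace_complete.
Context d (T : measurableType d) (R : realType).
Variables (mu : {measure set T -> \bar R}) (p : R) (p1 : (1 <= p%:E)%E).
Local Notation Lp := (LspaceType mu p1).
Local Notation Lf := (LfunType mu p1).

Let p1' : 1 <= p. Proof. by rewrite -lee_fin. Qed.
Let p0 : 0 < p. Proof. by rewrite (lt_le_trans _ p1'). Qed.

(* The weights [2^k] make the sum of the [p]-th powers of the increments an
   integrable majorant that controls the sequence pointwise. *)
Lemma Lspace_geometric_cvg (f : nat -> Lf) :
  (forall k, `|Lclass (f k.+1) - Lclass (f k)| <= (4 ^+ k)^-1) ->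
  exists (l : Lp) (S : R), 0 <= S /\ forall k, `|l - Lclass (f k)| <= S / 2 ^+ k.
Proof.
move=> fc; pose D k t : R := 2 ^+ k * `|f k.+1 t - f k t|.
have mD k : measurable_fun setT (fun t => D k t `^ p).
  apply: (measurableT_comp (measurable_powR _)).
  apply: measurable_funM => //; apply: measurableT_comp => //.
  by apply: measurable_funB; exact: measurable_Lfun.
pose H t : \bar R := (\sum_(0 <= k <oo) (D k t `^ p)%:E)%E.
have D0 k t : (0 <= (D k t `^ p)%:E)%E by rewrite lee_fin powR_ge0.
have H0 t : (0 <= H t)%E by exact: nneseries_ge0.
have mH : measurable_fun setT H.
  apply: ge0_emeasurable_sum => // k *; exact/measurable_EFinP.
have DH k t : ((D k t `^ p)%:E <= H t)%E.
  apply: (le_trans _ (@nneseries_lim_ge _ _ xpredT 0%N k.+1 _)) => //.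
  by rewrite big_nat_recr//= leeDr// sume_ge0.
(* The integral is at most [(2 ^ k / 4 ^ k) ^ p], hence at most [1 / 2 ^ k] as [p >= 1]. *)
have ID k : (\int[mu]_t (D k t `^ p)%:E <= (1 / 2 ^+ k)%:E)%E.
  have -> : (\int[mu]_t (D k t `^ p)%:E =
      \int[mu]_t (((2 ^+ k) `^ p)%:E * (`|(f k.+1 - f k) t| `^ p)%:E))%E.
    by apply: eq_integral => t _; rewrite -EFinM /D powRM.
  rewrite ge0_integralZl_EFin ?powR_ge0//; last first.
    exact/measurable_EFinP/measurable_norm_powR/measurable_Lfun.
  rewrite -normp_Lclass_EFin -EFinM lee_fin LclassB.
  rewrite -powRM// (@le_trans _ _ ((1 / 2 ^+ k) `^ p))//.
    rewrite ge0_ler_powR ?nnegrE ?(ltW p0) ?mulr_ge0 ?divr_ge0//.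
    rewrite div1r -ler_pdivlMl ?exprn_gt0// (le_trans (fc k))//.
    by rewrite -invfM -exprMn -natrM.
  rewrite ge1r_powR// divr_gt0 ?exprn_gt0//= div1r invf_le1 ?exprn_gt0//.
  by rewrite exprn_ege1// ler1n.
have IH : (\int[mu]_t H t <= 2%:E)%E.
  rewrite integral_nneseries//; last by move=> k; exact/measurable_EFinP.
  apply: (@le_trans _ _ (\sum_(0 <= k <oo) (1 / 2 ^+ k)%:E)%E).
    by apply: lee_nneseries => // k _ _; exact: integral_ge0.
  have := @cvg_geometric_eseries_half R 2 0%N; rewrite expr0 divr1 => /cvg_lim <-//.
  apply: lee_nneseries => [k _ _|k _]; first by rewrite lee_fin divr_ge0.
  by rewrite lee_fin addn1 natrX exprS invfM mulrA divff.
pose E := [set t | (H t < +oo)%E].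
have mE : measurable E by rewrite -[E]setTI; exact: emeasurable_fun_infty_o.
pose g k t := f k t * \1_E t.
have mg k : measurable_fun setT (g k).
  by apply: measurable_funM; [exact: measurable_Lfun|exact: measurable_indic].
have gE t : exists l : R, g ^~ t @ \oo --> l /\ forall k,
    ((`|l - f k t| `^ p)%:E <= ((2 / 2 ^+ k) `^ p)%:E * H t)%E.
  have ck k : 0 < (2 / 2 ^+ k) `^ p by rewrite powR_gt0// divr_gt0// exprn_gt0.
  have [Et|nEt] := pselect (E t); last first.
    exists 0; split.
      rewrite (_ : g ^~ t = fun=> 0); first exact: cvg_cst.
      by apply/funext => k; rewrite /g indicE memNset// mulr0.
    move=> k; move: nEt; rewrite /E/= ltey => /negP; rewrite negbK => /eqP ->.
    by rewrite gt0_muley ?leey// lte_fin.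
  have gf : g ^~ t = f ^~ t.
    by apply/funext => k; rewrite /g indicE mem_set// mulr1.
  have Hfin : H t \is a fin_num by rewrite ge0_fin_numE.
  pose c := fine (H t) `^ p^-1.
  have fkc k : `|f k.+1 t - f k t| <= c / 2 ^+ k.
    rewrite ler_pdivlMr ?exprn_gt0// mulrC -/(D k t).
    rewrite -[leLHS](@powRKV _ p) ?gt_eqF ?mulr_ge0//.
    rewrite ge0_ler_powR ?invr_ge0 ?nnegrE ?powR_ge0 ?fine_ge0 ?(ltW p0)//.
    by rewrite -lee_fin fineK.
  have [l lf lb] := geometric_cauchy fkc; exists l; split; first by rewrite gf.
  move=> k; rewrite -(fineK Hfin) -EFinM lee_fin.
  have -> : fine (H t) = c `^ p.
    by rewrite /c -powRrM mulVf ?gt_eqF// powRr1 ?fine_ge0.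
  rewrite -powRM ?powR_ge0 ?divr_ge0//.
  rewrite ge0_ler_powR ?nnegrE ?(ltW p0) ?mulr_ge0 ?powR_ge0 ?divr_ge0//.
  by rewrite mulrAC.
pose G t : R := sval (cid (gE t)); have GP t := svalP (cid (gE t)).
have mG : measurable_fun setT G.
  by apply: (measurable_fun_cvg mg) => t _; have [] := GP t.
have Gb k : (\int[mu]_t (`|G t - f k t| `^ p)%:E <= ((2 / 2 ^+ k) `^ p * 2)%:E)%E.
  apply: (@le_trans _ _ (\int[mu]_t (((2 / 2 ^+ k) `^ p)%:E * H t))%E).
    apply: ge0_le_integral => //.
    - apply/measurable_EFinP; apply: measurable_norm_powR.
      by apply: measurable_funB => //; exact: measurable_Lfun.
    - exact: measurable_funeM.
    - by move=> t _; have [] := GP t.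
  by rewrite ge0_integralZl_EFin ?powR_ge0// EFinM lee_wpmul2l// lee_fin powR_ge0.
(* The bound at [k = 0] puts the difference [G - f 0] in [L_p]; adding [f 0] back gives the
   limit. *)
have Gf : (fun t => G t - f 0%N t) \in Lfun mu p%:E.
  apply: mem_Lfun; last by apply: (le_lt_trans (Gb 0%N)); rewrite ltry.
  by apply: measurable_funB => //; exact: measurable_Lfun.
exists (Lclass (Lfun_Sub p1 Gf + f 0%N)), (2 * 2 `^ p^-1); split.
  by rewrite mulr_ge0 ?powR_ge0.
move=> k; rewrite -LclassB.
set u := Lclass _; rewrite -[leLHS](@powRKV _ p) ?gt_eqF//.
have -> : 2 * 2 `^ p^-1 / 2 ^+ k = ((2 / 2 ^+ k) `^ p * 2) `^ p^-1.
  rewrite powRM ?powR_ge0// -powRrM mulfV ?gt_eqF// powRr1 ?divr_ge0//.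
  by rewrite mulrAC.
rewrite ge0_ler_powR ?invr_ge0 ?nnegrE ?powR_ge0 ?mulr_ge0 ?powR_ge0 ?(ltW p0)//.
rewrite -lee_fin normp_Lclass_EFin (le_trans _ (Gb k))// le_eqVlt; apply/orP; left.
apply/eqP/eq_integral => t _; congr (`|_| `^ p)%:E.
by rewrite -[in RHS](subrK (f 0%N t) (G t)).
Qed.

End Lspace_complete.

(** * Multiplication operators and changes of density *)

Section density.
Import HBNNSimple.
Context d (T : measurableType d) (R : realType).
Variables (nu : {measure set T -> \bar R}) (w : T -> R).
Hypotheses (mw : measurable_fun setT w) (w0 : forall t, 0 <= w t).
Local Open Scope ereal_scope.

(* The proofs are arguments so that the measure structure can be inferred. *)
Definition density & measurable_fun setT w & (forall t, (0 <= w t)%R) :=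
  fun A : set T => \int[nu]_(t in A) (w t)%:E.
Local Notation dens := (density mw w0).

Let mw' : measurable_fun setT (EFin \o w). Proof. exact/measurable_EFinP. Qed.

Let density0 : dens set0 = 0. Proof. exact: integral_set0. Qed.

Let density_ge0 A : 0 <= dens A. Proof. by apply: integral_ge0 => t _; rewrite lee_fin. Qed.

Let density_sigma_additive : semi_sigma_additive dens.
Proof.
move=> F mF tF mU; rewrite /density ge0_integral_bigcup//; last 2 first.
  - exact: measurable_funTS.
  - by move=> t _; rewrite lee_fin.
apply: is_cvg_nneseries => n _ _; exact: density_ge0.
Qed.

HB.instance Definition _ := isMeasure.Build _ _ _ dens
  density0 density_ge0 density_sigma_additive.

Let integral_density_nnsfun (h : {nnsfun T >-> R}) :
  \int[dens]_t (h t)%:E = \int[nu]_t ((h t)%:E * (w t)%:E).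
Proof.
rewrite integralT_nnsfun sintegralE.
under [RHS]eq_integral.
  move=> t _; rewrite fimfunE -fsumEFin// ge0_mule_fsuml; last first.
    by move=> r; rewrite EFinM nnfun_muleindic_ge0.
  over.
rewrite [RHS]ge0_integral_fsum//; last 2 first.
  - move=> r; apply: emeasurable_funM => //.
    by apply/measurable_EFinP; do 2 apply/measurableT_comp => //.
  - move=> n t _; apply: mule_ge0; last by rewrite lee_fin.
    by rewrite EFinM nnfun_muleindic_ge0.
apply: eq_fsbigr => r; rewrite inE => -[t0 _ <-].
have mh : measurable (h @^-1` [set h t0]) by exact: measurable_funPTI.
rewrite /= /density integral_mkcond -ge0_integralZl//; last 3 first.
- exact: ((measurable_restrictT _ mh).1 (measurable_funTS mw')).
- by move=> t _; apply: erestrict_ge0 => u _; rewrite lee_fin.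
- by rewrite lee_fin.
apply: eq_integral => t _; rewrite EFinM -muleA /patch; congr (_ * _).
by rewrite indicE; case: ifPn; rewrite ?mul1e ?mul0e.
Qed.

(** Simple functions satisfy this by linearity, and monotone convergence along [nnsfun_approx]
    carries it over to [f]. *)
Lemma ge0_integral_density (f : T -> \bar R) : measurable_fun setT f ->
  (forall t, 0 <= f t) -> \int[dens]_t f t = \int[nu]_t (f t * (w t)%:E).
Proof.
move=> mf f0; pose f_ := nnsfun_approx measurableT mf.
have f_cvg t : EFin \o f_ ^~ t @ \oo --> f t by exact: cvg_nnsfun_approx.
have f_nd t : {homo (fun n => (f_ n t)%:E) : a b / (a <= b)%N >-> a <= b}.
  by move=> a b ab; rewrite lee_fin//; exact/lefP/nd_nnsfun_approx.
transitivity (limn (fun n => \int[dens]_t (f_ n t)%:E)).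
  rewrite -monotone_convergence//=.
  - by apply: eq_integral => t _; apply/esym/cvg_lim => //=; exact: f_cvg.
  - by move=> n; apply/measurable_EFinP.
  - by move=> n t _; rewrite lee_fin.
under eq_fun do rewrite integral_density_nnsfun.
rewrite -monotone_convergence//=.
- apply: eq_integral => t _; apply/cvg_lim => //.
  by apply: cvgeZr => //; exact: f_cvg.
- move=> n; apply: emeasurable_funM => //; exact/measurable_EFinP.
- by move=> n t _; rewrite mule_ge0 ?lee_fin.
- by move=> t _ a b ab; rewrite lee_wpmul2r ?lee_fin// -lee_fin f_nd.
Qed.

End density.

Section multiplication.
Context d (T : measurableType d) (R : realType).
Variables (nu mu : {measure set T -> \bar R}) (p : R) (p1 : (1 <= p%:E)%E).
Variable h : T -> R.
Hypothesis mh : measurable_fun setT h.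
Hypothesis hc : forall f : T -> R, measurable_fun setT f ->
  (\int[mu]_t (`|h t * f t| `^ p)%:E <= \int[nu]_t (`|f t| `^ p)%:E)%E.

Lemma mul_Lfun_subproof (f : LfunType nu p1) : (fun t => h t * f t) \in Lfun mu p%:E.
Proof.
have mf := measurable_Lfun f; apply: mem_Lfun; first exact: measurable_funM.
by rewrite (le_lt_trans (hc mf))// -normp_Lclass_EFin ltry.
Qed.

Definition mul_Lfun f : LfunType mu p1 := Lfun_Sub p1 (mul_Lfun_subproof f).

(** The contraction [hc] at [f - g] gives norm zero for the difference of the images, so
    multiplication is well defined on classes even though the two measures differ. *)
Lemma eq_mul_Lfun f g : Lclass f = Lclass g -> Lclass (mul_Lfun f) = Lclass (mul_Lfun g).
Proof.
move=> fg; apply/eqP; rewrite -subr_eq0; apply/eqP/normp_eq0.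
rewrite -LclassB -lee_fin normp_Lclass_EFin.
have -> : 0%:E = (\int[nu]_t (`|(f - g) t| `^ p)%:E)%E.
  rewrite -normp_Lclass_EFin LclassB fg subrr normr0 powR0//.
  by rewrite gt_eqF// (lt_le_trans ltr01)// -lee_fin.
rewrite (le_trans _ (hc (measurable_Lfun (f - g))))// le_eqVlt; apply/orP; left.
by apply/eqP; apply: eq_integral => t _; rewrite mulrBr.
Qed.

Definition mulL (u : LspaceType nu p1) : LspaceType mu p1 :=
  Lclass (mul_Lfun (Lfun_of u)).

Lemma mulLE f : mulL (Lclass f) = Lclass (mul_Lfun f).
Proof. by apply: eq_mul_Lfun; rewrite Lfun_ofK. Qed.

Lemma mulL_linear : linear mulL.
Proof.
move=> a u v; rewrite -[u]Lfun_ofK -[v]Lfun_ofK -LclassZ -LclassD !mulLE.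
rewrite -LclassZ -LclassD; congr Lclass; apply/LfuneqP => t.
by rewrite /= mulrDr mulrCA.
Qed.

Lemma normp_mulL u :
  (`|mulL u| `^ p)%:E = (\int[mu]_t (`|h t * Lfun_of u t| `^ p)%:E)%E.
Proof. by rewrite normp_Lclass_EFin. Qed.

End multiplication.

(** * Restriction to a measurable set *)

Section restriction.
Context d (T : measurableType d) (R : realType).
Variables (mu : {measure set T -> \bar R}) (p : R) (p1 : (1 <= p%:E)%E).
Local Notation Lp := (LspaceType mu p1).
Local Notation Lf := (LfunType mu p1).
Implicit Types (A B : set T) (u x : Lp).

Let p1' : 1 <= p. Proof. by rewrite -lee_fin. Qed.
Let p0 : 0 < p. Proof. by rewrite (lt_le_trans _ p1'). Qed.
Let pN0 : p != 0. Proof. by rewrite gt_eqF. Qed.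

Lemma normp_indic A (y : R) t :
  `|\1_A t * y| `^ p = \1_A t * `|y| `^ p.
Proof. by rewrite indicE; case: (t \in A); rewrite ?mul1r// !mul0r normr0 powR0. Qed.

Lemma indic_contraction A : measurable A -> forall f : T -> R,
  measurable_fun setT f ->
  (\int[mu]_t (`|\1_A t * f t| `^ p)%:E <= \int[mu]_t (`|f t| `^ p)%:E)%E.
Proof.
move=> mA f mf; have mf' := measurable_norm_powR p mf.
apply: ge0_le_integral => //.
- apply/measurable_EFinP; apply: measurable_norm_powR.
  by apply: measurable_funM => //; exact: measurable_indic.
- exact/measurable_EFinP.
- by move=> t _; rewrite lee_fin normp_indic ler_piMl ?powR_ge0.
Qed.

Definition restr A (mA : measurable A) : Lp -> Lp :=
  mulL (measurable_indic mA) (indic_contraction mA).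

Lemma restr_linear A (mA : measurable A) : linear (restr mA).
Proof. exact: mulL_linear. Qed.

Lemma restr_id A (mA : measurable A) u :
  (forall t, ~ A t -> Lrepr u t = 0) -> restr mA u = u.
Proof.
move=> uA; rewrite -[RHS]Lfun_ofK; congr Lclass; apply/LfuneqP => t /=.
rewrite indicE; have [At|nAt] := boolP (t \in A); first by rewrite mul1r.
by rewrite mul0r uA//; move: nAt; rewrite notin_setE.
Qed.

Lemma restr_sub A B (mA : measurable A) (mB : measurable B) u :
  A `<=` B -> restr mA u = u -> restr mB u = u.
Proof.
move=> AB <-; rewrite {1}/restr mulLE; congr Lclass; apply/LfuneqP => t /=.
rewrite !indicE; have [At|nAt] := boolP (t \in A); last by rewrite mul0r mulr0.
by rewrite mul1r mem_set ?mul1r//; apply: AB; rewrite inE in At.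
Qed.

(** The two parts have disjoint supports, so [p]-th powers add pointwise. *)
Lemma restr_split A (mA : measurable A) u :
  `|u| `^ p = `|restr mA u| `^ p + `|u - restr mA u| `^ p.
Proof.
rewrite -[u in LHS]Lfun_ofK -[u in X in X - _]Lfun_ofK -LclassB !normp_Lclass.
rewrite -RintegralD//; try exact: integrable_Lfun.
apply: eq_Rintegral => t _.
transitivity (`|\1_A t * Lrepr u t| `^ p + `|(1 - \1_A t) * Lrepr u t| `^ p).
  rewrite indicE; case: (t \in A).
    by rewrite subrr mul1r mul0r normr0 powR0// addr0.
  by rewrite subr0 mul0r normr0 powR0// mul1r add0r.
by rewrite mulrBl mul1r.
Qed.

(** On [A] this is the pointwise tangent inequality; off [A], where [u] vanishes, both sides reduce
    to [|x| ^ p]. *)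
Lemma normp_gradient A (mA : measurable A) u x : restr mA u = u ->
  `|u| `^ p + grad u x + `|x - restr mA x| `^ p <= `|u + x| `^ p.
Proof.
pose m := mul_Lfun (p1 := p1) (measurable_indic mA) (indic_contraction mA).
(* Multiplying the representative by the indicator makes it vanish off [A] everywhere and not just
   almost everywhere. *)
suff key (f0 g : Lf) : `|Lclass (m f0)| `^ p + grad (Lclass (m f0)) (Lclass g) +
    `|Lclass g - Lclass (m g)| `^ p <= `|Lclass (m f0) + Lclass g| `^ p.
  move=> uA; have := key (Lfun_of u) (Lfun_of x).
  have PE v : Lclass (m (Lfun_of v)) = restr mA v by [].
  by rewrite !PE uA Lfun_ofK.
rewrite gradE -LclassB -LclassD !normp_Lclass.
set f := m f0; set h := g - _.
have If := integrable_Lfun f; have Ih := integrable_Lfun h.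
have Ifg := integrable_Lgrad f g.
have I1 : mu.-integrable setT (EFin \o (fun t => p * (spow (p - 1) (f t) * g t))).
  exact: (integrableZl measurableT p Ifg).
have I3 : mu.-integrable setT
    (EFin \o (fun t => `|f t| `^ p + p * (spow (p - 1) (f t) * g t))).
  exact: (integrableD measurableT If I1).
rewrite /Lgrad -!RintegralZl// -!RintegralD//; apply: le_Rintegral => //.
- exact: (integrableD measurableT I3 Ih).
- exact: integrable_Lfun.
- move=> t _; have -> : h t = (1 - \1_A t) * g t by rewrite mulrBl mul1r.
  have -> : f t = \1_A t * f0 t by [].
  have -> : (f + g) t = \1_A t * f0 t + g t by [].
  rewrite indicE; case: (t \in A); rewrite /= ?mul1r ?mul0r ?subrr ?subr0 ?mul0r.
    rewrite normr0 powR0// addr0 mulrA.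
    by have := powR_gradient (f0 t) (f0 t + g t) p1'; rewrite addrAC subrr add0r.
  by rewrite normr0 powR0// spow0 mul0r mulr0 !add0r mul1r.
Qed.

End restriction.

(** * Sequential completeness and closed ranges *)

Section normed_completeness.
Context (R : realType).
Implicit Types V Y Z : normedModType R.

Definition cauchy_seq V (u : nat -> V) :=
  forall e : R, 0 < e -> exists n, forall m, (n <= m)%N -> `|u m - u n| < e.

Definition tends_to V (u : nat -> V) (l : V) :=
  forall e : R, 0 < e -> exists n, forall m, (n <= m)%N -> `|l - u m| < e.

Definition seq_complete V := forall u : nat -> V, cauchy_seq u -> exists l, tends_to u l.

Lemma closed_approx V (A : set V) (l : V) : closed A ->
  (forall e : R, 0 < e -> exists2 a, A a & `|l - a| < e) -> A l.
Proof.
move=> cA H; apply: cA => B /nbhs_ballP[e /= e0 eB].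
have [a Aa la] := H e e0; exists a; split => //; apply: eB.
by rewrite -ball_normE.
Qed.

Lemma tends_to_closed V (A : set V) u l : closed A -> (forall n, A (u n)) ->
  tends_to u l -> A l.
Proof.
move=> cA Au ul; apply: (closed_approx cA) => e /ul[n nl].
by exists (u n) => //; exact: nl.
Qed.

Lemma norm_small_eq0 V (x : V) : (forall e : R, 0 < e -> `|x| <= e) -> x = 0.
Proof.
move=> H; apply/eqP; rewrite -normr_le0; apply/ler_addgt0Pr => e e0.
by rewrite add0r H.
Qed.

Lemma invS_small (e : R) : 0 < e -> exists n, forall m, (n <= m)%N -> m.+1%:R^-1 < e.
Proof.
move=> e0; exists (Num.truncn e^-1) => m nm.
rewrite invf_plt ?posrE//.
by rewrite (lt_le_trans (truncnS_gt _))// ler_nat ltnS.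
Qed.

Lemma approx_cauchy Y Z (C : R) (u : nat -> Y) (w : nat -> Z) (z : Z) :
  (forall m n, `|u m - u n| <= C * `|w m - w n|) ->
  (forall n, `|z - w n| < n.+1%:R^-1) -> cauchy_seq u.
Proof.
move=> uC uz e e0; pose K : R := `|C| + 1; have K0 : 0 < K by rewrite ltr_wpDl.
have e2K : 0 < e / (2 * K) by rewrite divr_gt0// mulr_gt0.
have [n nN] := invS_small e2K.
exists n => m nm; apply: (le_lt_trans (uC _ _)).
have H : `|w m - w n| < e / K.
  rewrite -(subrKA z) (le_lt_trans (ler_normD _ _))//.
  rewrite (_ : e / K = e / (2 * K) + e / (2 * K)); last by field; rewrite gt_eqF.
  have zu k : (n <= k)%N -> `|z - w k| < e / (2 * K).
    by move=> nk; rewrite (lt_trans (uz _)) ?nN.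
  by rewrite ltrD ?zu// distrC zu.
rewrite (@le_lt_trans _ _ (K * `|w m - w n|))//.
  by rewrite ler_wpM2r// /K (le_trans (ler_norm _))// lerDl.
by rewrite mulrC -ltr_pdivlMr.
Qed.

(** The lower bound turns approximants [f (u n)] of a limit point into a Cauchy sequence [u] in the
    domain; by the upper bound, [f] maps its limit to that point. *)
Lemma closed_range Y Z (f : {linear Y -> Z}) : seq_complete Y ->
  (exists C : R, forall y, `|f y| <= C * `|y|) ->
  (exists C : R, forall y, `|y| <= C * `|f y|) -> closed (range f).
Proof.
move=> Yc [D fD] [C fC] z cz.
have {}cz n : exists y, `|z - f y| < n.+1%:R^-1.
  have [] := cz (ball z n.+1%:R^-1); first exact: nbhsx_ballx.
  by move=> _ [[y _ <-]]; rewrite -ball_normE; exists y.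
have [u uz] := choice cz.
have [|l ul] := Yc u.
  by apply: (@approx_cauchy _ _ C u (f \o u) z) => // m n; rewrite /= -linearB.
exists l => //; apply/esym/eqP; rewrite -subr_eq0; apply/eqP/norm_small_eq0 => e e0.
pose K : R := `|D| + 1; have K0 : 0 < K by rewrite ltr_wpDl.
have e2 : 0 < e / 2 by rewrite divr_gt0.
have [n nN] := invS_small e2.
have [m mN] := ul (e / 2 / K) (divr_gt0 e2 K0).
pose k := maxn n m; rewrite -(subrKA (f (u k))) (le_trans (ler_normD _ _))//.
rewrite [leRHS]splitr lerD//.
  by rewrite (le_trans (ltW (uz _)))// ltW// nN// leq_maxl.
rewrite distrC -linearB (le_trans (fD _))// (@le_trans _ _ (K * `|l - u k|))//.
  by rewrite ler_wpM2r// /K (le_trans (ler_norm _))// lerDl.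
by rewrite mulrC -ler_pdivlMr// ltW// mN// leq_maxr.
Qed.

Lemma subspace_complete V (X : submodClosed V) : seq_complete V ->
  closed [set` X] -> seq_complete (subspace_type X).
Proof.
move=> Vc Xc u cu; have [|l ul] := Vc (fun n => val (u n)).
  by move=> e /cu[n nu]; exists n => m /nu.
have lX : l \in X by exact: (@tends_to_closed _ _ (fun n => val (u n)) l Xc (fun n => valP (u n))).
by exists (exist _ l lX) => e /ul[n nu]; exists n => m /nu.
Qed.

End normed_completeness.

(** A subsequence with increments below [4 ^ - k] converges by [Lspace_geometric_cvg], and a Cauchy
    sequence follows its subsequence. *)
Lemma Lspace_complete d (T : measurableType d) (R : realType)
    (mu : {measure set T -> \bar R}) (p : R) (p1 : (1 <= p%:E)%E) :
  seq_complete (LspaceType mu p1).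
Proof.
move=> u cu.
have e4 k : 0 < (4 ^+ k)^-1 / 2 :> R by rewrite divr_gt0// invr_gt0 exprn_gt0.
have [phi phiP] := choice (fun k => cu _ (e4 k)).
(* Partial sums make the indices monotone while keeping them above [phi k]. *)
pose psi k := (\sum_(j < k.+1) phi j)%N.
have phi_psi k : (phi k <= psi k)%N by rewrite /psi big_ord_recr/= leq_addl.
have psiS k : (psi k <= psi k.+1)%N by rewrite [leqRHS]/psi big_ord_recr/= leq_addr.
have near k m n : (psi k <= m)%N -> (psi k <= n)%N -> `|u m - u n| <= (4 ^+ k)^-1.
  move=> km kn; rewrite -(subrKA (u (phi k))) (le_trans (ler_normD _ _))//.
  rewrite [leRHS]splitr lerD//; last rewrite distrC.
    by rewrite ltW// phiP// (leq_trans _ km).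
  by rewrite ltW// phiP// (leq_trans _ kn).
have [l [S [S0 lS]]] : exists (l : LspaceType mu p1) (S : R), 0 <= S /\
    forall k, `|l - u (psi k)| <= S / 2 ^+ k.
  have [|l [S [S0 lS]]] := @Lspace_geometric_cvg _ _ _ mu p p1 (fun k => Lfun_of (u (psi k))).
    by move=> k; rewrite !Lfun_ofK near.
  by exists l, S; split => // k; have := lS k; rewrite Lfun_ofK.
exists l => e e0; have e2 : 0 < e / 2 by rewrite divr_gt0.
have [k1 k1P] := geometric_small S0 e2.
have [k2 k2P] := geometric_small (@ler01 R) e2.
pose k := maxn k1 k2; exists (psi k) => m km.
rewrite -(subrKA (u (psi k))) (le_lt_trans (ler_normD _ _))// [ltRHS]splitr ltrD//.
  by rewrite (le_lt_trans (lS k))// k1P// leq_maxl.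
rewrite (le_lt_trans (near k _ _ _ _))//.
rewrite (le_lt_trans _ (k2P k (leq_maxr _ _)))// div1r lef_pV2 ?posrE ?exprn_gt0//.
by rewrite lerXn2r ?nnegrE// ler_nat.
Qed.

(** * Supports of sequences and passage to a finite measure *)

Section support.
Context d (T : measurableType d) (R : realType).
Variables (nu : {measure set T -> \bar R}) (p : R) (p1 : (1 <= p%:E)%E).
Local Notation Lp := (LspaceType nu p1).

Let p1' : 1 <= p. Proof. by rewrite -lee_fin. Qed.
Let p0 : 0 < p. Proof. by rewrite (lt_le_trans _ p1'). Qed.
Let pN0 : p != 0. Proof. by rewrite gt_eqF. Qed.

(** Fixed representatives make this a genuine set, on which inclusions hold pointwise. *)
Definition supp (s : nat -> Lp) : set T := \bigcup_n [set t | Lrepr (s n) t != 0].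

Lemma measurable_supp s : measurable (supp s).
Proof.
apply: bigcupT_measurable => n; rewrite (_ : [set t | _] = Lrepr (s n) @^-1` [set~ 0]).
  by rewrite -[_ @^-1` _]setTI; apply: measurable_Lrepr => //; exact: measurableC.
by apply/seteqP; split=> t /= /eqP.
Qed.

Definition restr_supp s : Lp -> Lp := restr (measurable_supp s).

Lemma restr_supp_id s n : restr_supp s (s n) = s n.
Proof.
apply: restr_id => t nt; apply/eqP; rewrite -[_ == _]negbK; apply/negP => H.
by apply: nt; exists n.
Qed.

Lemma supp_sub s s' (r : nat -> nat) : (forall n, s n = s' (r n)) -> supp s `<=` supp s'.
Proof. by move=> ss' t [n _ /=]; rewrite ss' => nt; exists (r n). Qed.

(** Change of density: a weighted sum [W] of the [|s n| ^ p] is integrable and vanishes exactly off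
    [supp s]. With [mu = W nu], multiplication by [W ^ (- 1 / p)] is isometric on functions
    supported on [supp s]. *)
Lemma finite_weight (s : nat -> Lp) :
  exists (mu : {finite_measure set T -> \bar R})
         (Q : {linear Lp -> LspaceType mu p1}),
    forall u, `|Q u| = `|restr_supp s u|.
Proof.
pose f n := Lfun_of (s n).
(* With this weight the [n]-th term of [W] has integral at most [1 / 2 ^ (n + 1)]. *)
pose c n : R := (2 ^+ n.+1 * (1 + `|s n| `^ p))^-1.
have c0 n : 0 < c n by rewrite invr_gt0 mulr_gt0 ?exprn_gt0// ltr_wpDr ?powR_ge0.
pose W t : \bar R := (\sum_(0 <= n <oo) (c n * `|f n t| `^ p)%:E)%E.
have W0' n t : (0 <= (c n * `|f n t| `^ p)%:E)%E.
  by rewrite lee_fin mulr_ge0 ?powR_ge0// ltW.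
have W0 t : (0 <= W t)%E by exact: nneseries_ge0.
have mf n : measurable_fun setT (fun t => `|f n t| `^ p).
  exact/measurable_norm_powR/measurable_Lfun.
have mcf n : measurable_fun setT (fun t => (c n * `|f n t| `^ p)%:E).
  by apply/measurable_EFinP; exact: measurable_funM.
have mW : measurable_fun setT W by apply: ge0_emeasurable_sum.
have IW : (\int[nu]_t W t < +oo)%E.
  rewrite integral_nneseries//.
  apply: (@le_lt_trans _ _ 1%:E); last by rewrite ltry.
  have := @cvg_geometric_eseries_half R 1 0%N; rewrite expr0 divr1 => /cvg_lim <-//.
  apply: lee_nneseries => [n _ _|n _]; first exact: integral_ge0.
  under eq_integral do rewrite EFinM.
  rewrite ge0_integralZl_EFin ?(ltW (c0 n))//; last exact/measurable_EFinP.
  rewrite -normp_Lclass_EFin -EFinM lee_fin Lfun_ofK /c addn1 natrX.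
  rewrite invfM -mulrA div1r -[leRHS]mulr1 ler_pM2l ?invr_gt0 ?exprn_gt0//.
  by rewrite ler_pdivrMl ?mulr1 ?lerDr// ltr_wpDr ?powR_ge0.
(* [fine] sends the value [+oo] to 0, which affects only a null set because [W] is integrable. *)
pose w t := fine (W t).
have w0 t : 0 <= w t by rewrite fine_ge0.
have mw : measurable_fun setT w by exact: measurableT_comp.
have fin : fin_num_fun (density nu mw w0).
  apply: lty_fin_num_fun; apply: (le_lt_trans _ IW).
  have w0' t : [set: T] t -> (0 <= (w t)%:E)%E by rewrite lee_fin.
  have mw' : measurable_fun setT (EFin \o w) by exact/measurable_EFinP.
  apply: ge0_le_integral => // t _; rewrite /w; case: (W t) (W0 t) => //= *; rewrite leey.
pose mu : {finite_measure set T -> \bar R} :=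
  HB.pack_for {finite_measure set T -> \bar R} (density nu mw w0)
    (Measure_isFinite.Build _ _ _ (density nu mw w0) fin).
pose h t := w t `^ (- p^-1).
have mh : measurable_fun setT h by exact: (measurableT_comp (measurable_powR _)).
(* Almost everywhere, [|h * g| ^ p * w] equals [|g| ^ p] on [supp s], where [w] is nonzero, and 0
   elsewhere, where [w] vanishes. *)
have key (g : T -> R) : measurable_fun setT g ->
    (\int[mu]_t (`|h t * g t| `^ p)%:E = \int[nu]_t (`|\1_(supp s) t * g t| `^ p)%:E)%E.
  move=> mg; rewrite [LHS](_ : _ = \int[nu]_t ((`|h t * g t| `^ p)%:E * (w t)%:E))%E; last first.
    apply: ge0_integral_density; last by move=> t; rewrite lee_fin powR_ge0.
    by apply/measurable_EFinP/measurable_norm_powR; exact: measurable_funM.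
  apply: ge0_ae_eq_integral => //.
  - apply: emeasurable_funM; last exact/measurable_EFinP.
    by apply/measurable_EFinP/measurable_norm_powR; exact: measurable_funM.
  - apply/measurable_EFinP; apply: measurable_norm_powR; apply: measurable_funM => //.
    by apply: measurable_indic; exact: measurable_supp.
  - by move=> t _; rewrite -EFinM lee_fin mulr_ge0 ?powR_ge0.
  have : nu.-integrable setT W.
    by apply/integrableP; split => //; under eq_integral do rewrite gee0_abs//.
  move=> /(integrable_ae measurableT); apply: filterS => t /= /(_ I) Wfin _.
  rewrite -EFinM normrM powRM// (ger0_norm (powR_ge0 _ _)) /h -powRrM mulNr mulVf//.
  rewrite powRN powRr1// mulrAC normp_indic//; congr (_ * _)%:E.
  rewrite indicE; have [ts|ts] := boolP (t \in supp s).
    rewrite mulVf// /w fine_eq0//; rewrite inE in ts; case: ts => n _ /= nt.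
    rewrite gt_eqF// (lt_le_trans _ (@nneseries_lim_ge _ _ xpredT 0%N n.+1 _))//.
    rewrite big_nat_recr//= (@lt_le_trans _ _ (c n * `|f n t| `^ p)%:E)//.
      by rewrite lte_fin mulr_gt0// powR_gt0 ?normr_gt0.
    by rewrite leeDr// sume_ge0// => i _; exact: W0'.
  rewrite (_ : w t = 0) ?mulr0// /w /W eseries0// => n _ _.
  have -> : f n t = 0; last by rewrite normr0 powR0// mulr0.
  apply/eqP; rewrite -[_ == _]negbK; apply/negP => nt.
  by move: ts; rewrite notin_setE; apply; exists n.
have hc (g : T -> R) : measurable_fun setT g ->
    (\int[mu]_t (`|h t * g t| `^ p)%:E <= \int[nu]_t (`|g t| `^ p)%:E)%E.
  by move=> mg; rewrite key//; apply: indic_contraction => //; exact: measurable_supp.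
have [Q QE] := linear_packed (mulL_linear (p1 := p1) mh hc).
exists mu, Q => u; rewrite QE.
rewrite -[LHS](powRKV pN0 (normr_ge0 _)) -[RHS](powRKV pN0 (normr_ge0 _)).
congr (_ `^ _); apply/EFin_inj.
by rewrite !normp_mulL key.
Qed.

End support.

(** * The extension property *)

(** Finite lists of rational values with a rational tolerance are countably many; for each one that
    is met in [A], a point of [A] meeting it is chosen. Both [x] and the chosen point are then close
    to the same rationals. *)
Lemma countable_approx (R : realType) (V : Type) (A : set V) (a0 : V)
    (phi : nat -> V -> R) : A a0 ->
  exists d : nat -> V, (forall k, A (d k)) /\
    forall x n (e : R), A x -> 0 < e ->
      exists k, forall i, (i < n)%N -> `|phi i (d k) - phi i x| < e.
Proof.
move=> Aa0.
pose Q (q : seq rat * rat) v :=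
  A v /\ forall i, (i < size q.1)%N -> `|phi i v - ratr q.1`_i| < ratr q.2.
pose D q := if pselect (exists v, Q q v) is left H then sval (cid H) else a0.
have DA q : A (D q).
  by rewrite /D; case: pselect => // H; case: (cid H) => v [].
have DQ q v : Q q v -> Q q (D q).
  by rewrite /D => Qv; case: pselect => [H|[]]; [case: (cid H)|exists v].
exists (fun k => D (odflt (nil, 0) (unpickle k))); split => [k|x n e Ax e0].
  exact: DA.
have e2 : 0 < e / 2 by rewrite divr_gt0.
have [del /itvP del0e] := rat_in_itvoo e2.
have del0 : 0 < ratr del :> R by rewrite del0e.
have q_ i : exists q : rat, `|phi i x - ratr q| < ratr del.
  have [|q /itvP qi] := @rat_in_itvoo _ (phi i x - ratr del) (phi i x + ratr del).
    by rewrite ltrD2l gtrN.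
  by exists q; rewrite distrC ltr_distl !qi.
have [f fP] := choice q_.
pose q := (mkseq f n, del).
have Qx : Q q x.
  by split => // i; rewrite size_mkseq => iltn; rewrite nth_mkseq.
have [_ QD] := DQ _ _ Qx.
exists (pickle q) => i iltn; rewrite pickleK /=.
have := QD i; rewrite size_mkseq nth_mkseq// => /(_ iltn) H.
rewrite -(subrKA (ratr (f i))) (le_lt_trans (ler_normD _ _))//.
have d2 : ratr del < e / 2 by rewrite del0e.
rewrite [ltRHS]splitr ltrD ?(lt_trans H)//.
by rewrite distrC (lt_trans (fP i)).
Qed.

(** * Real and rational linear combinations *)

Section combinations.
Context (R : realType) (V : lmodType R).
Implicit Types (s : nat -> V).

Definition comb (I : Type) (s : I -> V) (l : seq (R * I)) : V :=
  \sum_(k <- l) k.1 *: s k.2.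

Lemma comb_cons (I : Type) (s : I -> V) k l : comb s (k :: l) = k.1 *: s k.2 + comb s l.
Proof. exact: big_cons. Qed.

Lemma comb_cat (I : Type) (s : I -> V) l l' : comb s (l ++ l') = comb s l + comb s l'.
Proof. exact: big_cat. Qed.

Lemma combZ (I : Type) (s : I -> V) a l :
  comb s [seq (a * k.1, k.2) | k <- l] = a *: comb s l.
Proof.
by rewrite /comb big_map scaler_sumr; apply: eq_bigr => k _; rewrite scalerA.
Qed.

Lemma comb_map (I J : Type) (s : J -> V) (r : I -> J) l :
  comb s [seq (k.1, r k.2) | k <- l] = comb (s \o r) l.
Proof. by rewrite /comb big_map. Qed.

Lemma perm_comb (I : eqType) (s : I -> V) l l' : perm_eq l l' -> comb s l = comb s l'.
Proof. exact: perm_big. Qed.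

(** Rational coefficients leave countably many combinations, hence countably many gradient
    functionals; real ones are reached by continuity. *)
Definition rcomb s (l : seq (rat * nat)) : V :=
  \sum_(k <- l) (ratr k.1 : R) *: s k.2.

Lemma rcombE s (l : seq (rat * nat)) : rcomb s l = comb s [seq (ratr k.1, k.2) | k <- l].
Proof. by rewrite /comb big_map. Qed.

Lemma rcomb_reindex s s' (r : nat -> nat) (l : seq (rat * nat)) : (forall n, s n = s' (r n)) ->
  rcomb s l = rcomb s' [seq (k.1, r k.2) | k <- l].
Proof. by move=> ss'; rewrite /rcomb big_map; apply: eq_bigr => k _; rewrite ss'. Qed.

Lemma merge_sequences (A : set V) (t : nat -> nat -> V) : A 0 -> (forall n k, A (t n k)) ->
  exists s, (forall k, A (s k)) /\ forall n, exists r : nat -> nat, forall k, t n k = s (r k).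
Proof.
(* Indices that encode no pair get the default 0, whence the hypothesis [A 0]. *)
move=> A0 At; exists (fun k => if unpickle k is Some (n, m) then t n m else 0); split.
  by move=> k; case: unpickle => [[]|].
by move=> n; exists (fun k => pickle (n, k)) => k; rewrite pickleK.
Qed.

End combinations.

Lemma rcomb_approx (R : realType) (V : normedModType R) (s : nat -> V) l (e : R) :
  0 < e -> exists l', `|comb s l - rcomb s l'| < e.
Proof.
elim: l e => [|[r i] l ih] e e0.
  by exists [::]; rewrite /comb /rcomb !big_nil subrr normr0.
have e2 : 0 < e / 2 by rewrite divr_gt0.
have [l' l'P] := ih _ e2.
have K0 : 0 < `|s i| + 1 by rewrite ltr_wpDl.
have [|q /itvP qi] := @rat_in_itvoo _ r (r + e / 2 / (`|s i| + 1)).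
  by rewrite ltrDl divr_gt0.
exists ((q, i) :: l'); rewrite /comb /rcomb !big_cons/= -/(comb s l) -/(rcomb s l').
rewrite opprD addrACA -scalerBl (le_lt_trans (ler_normD _ _))// [ltRHS]splitr ltrD//.
rewrite normrZ distrC gtr0_norm ?subr_gt0 ?qi//.
rewrite (@le_lt_trans _ _ ((ratr q - r) * (`|s i| + 1)))//.
  by rewrite ler_wpM2l ?lerDl// subr_ge0 ltW// qi.
by rewrite -ltr_pdivlMr// ltrBlDl qi.
Qed.

(** * Gradient functionals and norm minimization under constraints *)

Section kernels.
Context d (T : measurableType d) (R : realType).
Variables (nu : {measure set T -> \bar R}) (p : R) (p1 : (1 <= p%:E)%E).
Local Notation Lp := (LspaceType nu p1).
Implicit Types (s : nat -> Lp) (u x y : Lp).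

Let p1' : 1 <= p. Proof. by rewrite -lee_fin. Qed.
Let p0 : 0 < p. Proof. by rewrite (lt_le_trans _ p1'). Qed.
Let pN0 : p != 0. Proof. by rewrite gt_eqF. Qed.

Lemma normp_lt u (e : R) : 0 < e -> `|u| `^ p < e `^ p -> `|u| < e.
Proof.
move=> e0; rewrite !ltNge; apply: contra => eu.
by rewrite ge0_ler_powR ?nnegrE ?(ltW p0) ?(ltW e0).
Qed.

Lemma normpZ a u : `|a *: u| `^ p = `|a| `^ p * `|u| `^ p.
Proof. by rewrite normrZ powRM. Qed.

Lemma grad0 u : grad u 0 = 0.
Proof.
have := grad_linear u 1 0 0; rewrite scaler0 addr0 mul1r => /eqP.
by rewrite -subr_eq0 opprD addrA subrr sub0r oppr_eq0 => /eqP.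
Qed.

Lemma gradZ u a x : grad u (a *: x) = a * grad u x.
Proof. by rewrite -[a *: x]addr0 grad_linear grad0 addr0. Qed.

(** [grad_bounded] is not homogeneous in [x]; it is applied to the normalized vector and scaled
    back. *)
Lemma grad_norm u x : `|grad u x| <= p * (`|u| `^ p + 1) * `|x|.
Proof.
have [->|x0] := eqVneq x 0; first by rewrite grad0 !normr0 mulr0.
have nx : 0 < `|x| by rewrite normr_gt0.
have := grad_bounded u (`|x|^-1 *: x); rewrite gradZ normpZ -powRM// normrM.
rewrite normfV normr_id mulVf ?gt_eqF// powR1 => H.
by rewrite mulrC -ler_pdivrMl.
Qed.

(* [y] is the limit of vectors of the countable family that almost minimize
   [|.|^p] under finitely many approximate constraints [f i z = f i x]; it exists
   by uniform convexity. *)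
Lemma constrained_selection (X : submodClosed Lp) (f : nat -> Lp -> R) :
  1 < p <= 2 -> closed [set` X] ->
  (forall i a x y, f i (a *: x + y) = a * f i x + f i y) ->
  (forall i, exists K : R, forall x, `|f i x| <= K * `|x|) ->
  exists v : nat -> Lp, (forall k, v k \in X) /\
    forall x, x \in X -> exists2 y, y \in X /\ (forall i, f i y = f i x) &
      forall e : R, 0 < e -> exists k, `|y - v k| < e.
Proof.
move=> p12 Xc fl fK.
(* Index 0 records the norm, so the functionals are shifted by one. *)
pose phi i : Lp -> R := if i is i.+1 then f i else fun x => `|x| `^ p.
have [v [vX vd]] := countable_approx phi (rpred0 X : [set` X] 0).
exists v; split => [k|x xX]; first exact: vX.
pose Z n := [set z | z \in X /\ forall i, (i < n)%N -> `|f i z - f i x| < n.+1%:R^-1].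
have Zx n : Z n x by split => // i _; rewrite subrr normr0 invr_gt0.
have inv_le m n : (m <= n)%N -> n.+1%:R^-1 <= m.+1%:R^-1 :> R.
  by move=> mn; rewrite lef_pV2 ?posrE// ler_nat.
have Zsub m n : (m <= n)%N -> Z n `<=` Z m.
  move=> mn z [zX zi]; split => // i im.
  by rewrite (lt_le_trans (zi _ (leq_trans im mn)))// inv_le.
pose N n := [set `|z| `^ p | z in Z n].
have N0 n : N n !=set0 by exists (`|x| `^ p), x.
have Nlb n : has_lbound (N n) by exists 0 => _ [z _ <-]; exact: powR_ge0.
pose m n := inf (N n).
have mle n z : Z n z -> m n <= `|z| `^ p.
  by move=> Zz; apply: ge_inf => //; exists z.
(* The infima [m n] increase as the constraints tighten and stay below [|x| ^ p], since [x]
   satisfies all constraints. *)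
pose M := sup (range m).
have hM : has_sup (range m).
  split; first by exists (m 0%N), 0%N.
  by exists (`|x| `^ p) => _ [n _ <-]; exact: mle.
have mM n : m n <= M by apply: sup_upper_bound => //; exists n.
have M0 : 0 <= M.
  rewrite (le_trans _ (mM 0%N))// lb_le_inf// => _ [z _ <-]; exact: powR_ge0.
have f0 i : f i 0 = 0.
  have := fl i 1 0 0; rewrite scaler0 addr0 mul1r => /eqP.
  by rewrite -subr_eq0 opprD addrA subrr sub0r oppr_eq0 => /eqP.
have fZ i a u : f i (a *: u) = a * f i u.
  by have := fl i a u 0; rewrite !addr0 f0 addr0.
have fB i u w : f i (u - w) = f i u - f i w.
  by have := fl i (- 1) w u; rewrite scaleN1r addrC => ->; rewrite mulN1r addrC.
have half n : (n.*2.+2%:R : R)^-1 + (n.*2.+2%:R)^-1 = n.+1%:R^-1.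
  rewrite -doubleS -muln2 natrM; have : (n.+1%:R : R) != 0 by rewrite pnatr_eq0.
  by move: (n.+1%:R : R) => b b0; field.
(* Take a near minimizer in [Z (2n + 1)] and approximate it by some [v k]: each move costs at most
   [1 / (2n + 2)], half of the allowed [1 / (n + 1)]. *)
have wn n : exists k, Z n (v k) /\ `|v k| `^ p < M + n.+1%:R^-1.
  have e0 : 0 < (n.*2.+2%:R : R)^-1 by rewrite invr_gt0.
  have [_ [z Zz <-] zm] := inf_adherent e0 (conj (N0 n.*2.+1) (Nlb _)).
  have [k kP] := vd z n.*2.+2 _ Zz.1 e0.
  exists k; split; [split => [|i iltn]|]; first exact: vX.
  - rewrite -(subrKA (f i z)) (le_lt_trans (ler_normD _ _))// -half ltrD//.
      by apply: (kP i.+1); rewrite !ltnS -addnn (leq_trans (ltnW iltn))// leq_addr.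
    by apply: Zz.2; rewrite ltnS -addnn (leq_trans (ltnW iltn))// leq_addr.
  - have := kP 0%N isT; rewrite /= ltr_norml => /andP[_].
    by have := mM n.*2.+1; move: zm; rewrite -(half n) /m; move: (inf _) (n.*2.+2%:R^-1) => I q; lra.
have [g gP] := choice wn.
have wc : cauchy_seq (fun n => v (g n)).
  move=> e e0; pose eta := e `^ p; have eta0 : 0 < eta by rewrite powR_gt0.
  have M1 : 0 < M + 1 by rewrite ltr_wpDl.
  (* [eps] here and [e'] below make each of the two terms of the uniform convexity bound at most
     [eta / 2]. *)
  pose eps := eta / (4 * (M + 1)).
  have eps0 : 0 < eps by rewrite divr_gt0// mulr_gt0.
  have [C C0 UC] := @normp_unif_convex _ _ _ nu p p1 _ p12 eps0.
  pose e' := eta / (4 * C); have e'0 : 0 < e' by rewrite divr_gt0// mulr_gt0.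
  have [_ [n1 _ <-] n1P] := sup_adherent e'0 hM.
  have [n2 n2P] := invS_small e'0.
  exists (maxn n1 n2) => k nk; apply: normp_lt => //.
  apply: (le_lt_trans (UC _ _)).
  set a := v (g k); set b := v (g _).
  have [Za aM] := gP k; have [Zb bM] := gP (maxn n1 n2).
  rewrite -/a in Za aM; rewrite -/b in Zb bM.
  have {}Za : Z n1 a by apply: Zsub Za; exact: leq_trans (leq_maxl _ _) nk.
  have {}Zb : Z n1 b by apply: Zsub Zb; exact: leq_maxl.
  have aM1 : `|a| `^ p <= M + 1.
    by rewrite (le_trans (ltW aM))// lerD2l invf_le1// ler1n.
  have bM1 : `|b| `^ p <= M + 1.
    by rewrite (le_trans (ltW bM))// lerD2l invf_le1// ler1n.
  have ae' : `|a| `^ p < M + e'.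
    by rewrite (lt_trans aM)// ltrD2l n2P// (leq_trans (leq_maxr _ _) nk).
  have be' : `|b| `^ p < M + e' by rewrite (lt_trans bM)// ltrD2l n2P// leq_maxr.
  (* [Z n1] is convex, so the midpoint competes for the infimum [m n1 > M - e']; the convexity gap
     is then below [2 * e']. *)
  have mid : m n1 <= `|2^-1 *: (a + b)| `^ p.
    apply: mle; split => [|i iltn]; first by rewrite rpredZ// rpredD// ?Za.1 ?Zb.1.
    have -> : f i (2^-1 *: (a + b)) - f i x =
        2^-1 * (f i a - f i x) + 2^-1 * (f i b - f i x).
      by rewrite fZ -[a]scale1r fl scale1r mul1r; field.
    have h2 : `|2^-1 : R| = 2^-1 by rewrite ger0_norm.
    rewrite (le_lt_trans (ler_normD _ _))// !normrM !h2.
    have := Za.2 i iltn; have := Zb.2 i iltn.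
    by move: (n1.+1%:R^-1) `|f i a - _| `|f i b - _| => q r1 r2; lra.
  have : eps * (`|a| `^ p + `|b| `^ p) <= eta / 2.
    rewrite (@le_trans _ _ (eps * ((M + 1) + (M + 1))))//.
      by rewrite ler_pM2l// lerD.
    have E (h k1 : R) : k1 != 0 -> h / (4 * k1) * (k1 + k1) = h / 2.
      by move=> k10; field.
    by rewrite /eps E// gt_eqF.
  have : C * ((`|a| `^ p + `|b| `^ p) / 2 - `|2^-1 *: (a + b)| `^ p) < eta / 2.
    rewrite (@lt_le_trans _ _ (C * (2 * e')))//.
      have n1P' : M - e' < m n1 by [].
      rewrite ltr_pM2l//; move: ae' be' mid n1P'; clear.
      by move: (M) (e') (m n1) (`|a| `^ p) (`|b| `^ p) (`|_| `^ p) => *; lra.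
    have E (h k1 : R) : k1 != 0 -> k1 * (2 * (h / (4 * k1))) = h / 2.
      by move=> k10; field.
    by rewrite /e' E// gt_eqF.
  by rewrite -/eta; lra.
have [y wy] := Lspace_complete wc.
have yX : y \in X.
  by apply: (@tends_to_closed _ _ [set` X] _ _ Xc _ wy) => n; exact: vX.
exists y; last by move=> e /wy[n ny]; exists (g n); exact: ny.
split => // i; apply/eqP; rewrite -subr_eq0; apply/eqP.
apply: (@norm_small_eq0 R R) => e e0; have e2 : 0 < e / 2 by rewrite divr_gt0.
have [K KP] := fK i; pose K' : R := `|K| + 1; have K'0 : 0 < K' by rewrite ltr_wpDl.
have [n1 n1P] := invS_small e2.
have [n2 n2P] := wy (e / 2 / K') (divr_gt0 e2 K'0).
pose n := maxn i.+1 (maxn n1 n2).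
rewrite -(subrKA (f i (v (g n)))) (le_trans (ler_normD _ _))// [leRHS]splitr lerD//.
  rewrite -fB (le_trans (KP _))// (@le_trans _ _ (K' * `|y - v (g n)|))//.
    by rewrite ler_wpM2r// /K' (le_trans (ler_norm _))// lerDl.
  by rewrite mulrC -ler_pdivlMr// ltW// n2P// /n !leq_max leqnn !orbT.
have [[_ Zn] _] := gP n; rewrite (le_trans (ltW (Zn i _)))//.
  by rewrite /n leq_max leqnn.
by rewrite ltW// n1P// /n !leq_max leqnn !orbT.
Qed.

Definition in_kernel (X : submodClosed Lp) s x :=
  x \in X /\ forall l, grad (rcomb s l) x = 0.

Lemma restr_restr A B (mA : measurable A) (mB : measurable B) u : A `<=` B ->
  restr mA (restr mB u) = restr mA u.
Proof.
move=> AB; rewrite {1}/restr mulLE; congr Lclass; apply/LfuneqP => t /=.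
rewrite !indicE; have [At|nAt] := boolP (t \in A); last by rewrite !mul0r.
by rewrite [t \in B]mem_set ?mul1r//; apply: AB; rewrite inE in At.
Qed.

Lemma restr_norm A (mA : measurable A) u : `|restr mA u| <= `|u|.
Proof.
rewrite -[leLHS](powRKV pN0 (normr_ge0 _)) -[leRHS](powRKV pN0 (normr_ge0 _)).
rewrite ge0_ler_powR ?invr_ge0 ?(ltW p0) ?nnegrE ?powR_ge0//.
by rewrite (restr_split mA u) lerDl powR_ge0.
Qed.

Lemma restrD A (mA : measurable A) u v : restr mA (u + v) = restr mA u + restr mA v.
Proof. by have := restr_linear mA 1 u v; rewrite !scale1r. Qed.

Lemma restr0 A (mA : measurable A) : restr mA (0 : Lp) = 0.
Proof. by apply: (@addrI _ (restr mA (0 : Lp))); rewrite -restrD !addr0. Qed.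

Lemma restrZ A (mA : measurable A) a u : restr mA (a *: u) = a *: restr mA u.
Proof. by have := restr_linear mA a u 0; rewrite !addr0 restr0 addr0. Qed.

Lemma restrB A (mA : measurable A) u v : restr mA (u - v) = restr mA u - restr mA v.
Proof. by rewrite -scaleN1r restrD restrZ scaleN1r. Qed.

Lemma restr_resid A B (mA : measurable A) (mB : measurable B) u : A `<=` B ->
  `|u - restr mB u| `^ p <= `|u - restr mA u| `^ p.
Proof.
move=> AB; have := restr_split mA u; have := restr_split mB u.
have := restr_split mA (restr mB u); rewrite (restr_restr _ _ _ AB).
by have := normp_ge0 (restr mB u - restr mA u); lra.
Qed.

Lemma restr_suppD s u v : restr_supp s (u + v) = restr_supp s u + restr_supp s v.
Proof. exact: restrD. Qed.

Lemma restr_suppZ s a u : restr_supp s (a *: u) = a *: restr_supp s u.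
Proof. exact: restrZ. Qed.

Lemma restr_suppB s u v : restr_supp s (u - v) = restr_supp s u - restr_supp s v.
Proof. exact: restrB. Qed.

Lemma restr_comb s l : restr_supp s (comb s l) = comb s l.
Proof.
elim: l => [|k l ih]; rewrite /comb ?big_nil ?big_cons; first exact: restr0.
by rewrite restr_suppD restr_suppZ restr_supp_id; congr (_ + _); exact: ih.
Qed.

End kernels.

Section extension_property.
Context d (T : measurableType d) (R : realType).
Variables (nu : {measure set T -> \bar R}) (p : R) (p1 : (1 <= p%:E)%E).
Local Notation Lp := (LspaceType nu p1).
Implicit Types (s : nat -> Lp) (u x y : Lp).

Let p1' : 1 <= p. Proof. by rewrite -lee_fin. Qed.
Let p0 : 0 < p. Proof. by rewrite (lt_le_trans _ p1'). Qed.
Let pN0 : p != 0. Proof. by rewrite gt_eqF. Qed.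

(* If no [e] works, merging countably many witnesses gives [s] such that the kernel
   is supported on [supp s]; the selected vectors take care of the rest of [X]. *)
Lemma kernel_dichotomy (X : submodClosed Lp) : 1 < p <= 2 -> closed [set` X] ->
  (exists2 s, (forall n, s n \in X) & forall x, x \in X -> restr_supp s x = x) \/
  (exists2 e : R, 0 < e & forall s, (forall n, s n \in X) ->
    exists2 x, in_kernel X s x & e * `|x| `^ p < `|x - restr_supp s x| `^ p).
Proof.
move=> p12 Xc; have [B|nB] := pselect (exists2 e : R, 0 < e & forall s,
    (forall n, s n \in X) ->
    exists2 x, in_kernel X s x & e * `|x| `^ p < `|x - restr_supp s x| `^ p).
  by right.
left.
have {}nB n : exists s, (forall k, s k \in X) /\ forall x, in_kernel X s x ->
    `|x - restr_supp s x| `^ p <= n.+1%:R^-1 * `|x| `^ p.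
  apply: contrapT => H; apply: nB; exists n.+1%:R^-1 => // s sX.
  apply: contrapT => Hs; apply: H; exists s; split => // x xk.
  by rewrite leNgt; apply/negP => lt; apply: Hs; exists x.
have [t tP] := choice nB.
have X0 : [set` X] 0 by exact: rpred0.
have tX n k : [set` X] (t n k) by exact: (tP n).1.
have [S [SX St]] := merge_sequences X0 tX.
(* Combinations of [t n] are combinations of [S], and a larger support leaves a smaller residue; so
   the residue is at most [|x| ^ p / (n + 1)] for every [n]. *)
have kS x : in_kernel X S x -> restr_supp S x = x.
  move=> [xX xk]; apply/esym/eqP; rewrite -subr_eq0; apply/eqP/normp_eq0.
  apply/ler_addgt0Pr => e e0; rewrite add0r.
  have K0 : 0 < `|x| `^ p + 1 by rewrite ltr_wpDl ?powR_ge0.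
  have [n nP] := invS_small (divr_gt0 e0 K0).
  have [r rP] := St n.
  rewrite (le_trans (restr_resid (measurable_supp (t n)) _ _ (supp_sub rP)))//.
  have tk : in_kernel X (t n) x.
    split=> [|l]; first exact: xX.
    rewrite (rcomb_reindex l rP); exact: xk.
  apply: (le_trans ((tP n).2 x tk)).
  rewrite (@le_trans _ _ (n.+1%:R^-1 * (`|x| `^ p + 1)))//.
    by rewrite ler_wpM2l ?invr_ge0// lerDl.
  by rewrite -ler_pdivlMr// ltW// nP.
pose f i := grad (rcomb S (odflt [::] (unpickle i))).
have [v [vX vP]] : exists v : nat -> Lp, (forall k, v k \in X) /\
    forall x, x \in X -> exists2 y, y \in X /\ (forall i, f i y = f i x) &
      forall e : R, 0 < e -> exists k, `|y - v k| < e.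
  apply: constrained_selection => // i.
  - by move=> a x y; exact: grad_linear.
  - by eexists => x; exact: grad_norm.
pose t' n := if n is 0 then S else v.
have t'X n k : [set` X] (t' n k) by case: n => [|n]; [exact: SX|exact: vX].
have [S' [S'X S't]] := merge_sequences X0 t'X.
exists S' => // x xX.
have [y [yX fy] yv] := vP x xX.
have [r0 r0P] := S't 0%N; have [r1 r1P] := S't 1%N.
(* [x - y] is in the kernel of [S], because the selected [y] has the same values under all the
   [f i]; [y] itself is a limit of the [v k], which [S'] contains. *)
have Sx : restr_supp S' (x - y) = x - y.
  apply: (restr_sub (mA := measurable_supp S)); first exact: (supp_sub r0P).
  apply: kS; split => [|l]; first by rewrite -scaleN1r rpredD ?rpredZ.
  rewrite -scaleN1r addrC grad_linear mulN1r.
  by have := fy (pickle l); rewrite /f pickleK /= => ->; rewrite addNr.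
have Sy : restr_supp S' y = y.
  apply/esym/eqP; rewrite -subr_eq0; apply/eqP/norm_small_eq0 => e e0.
  have e2 : 0 < e / 2 by rewrite divr_gt0.
  have [k kP] := yv _ e2.
  have vk : restr_supp S' (v k) = v k by rewrite (r1P k : v k = _) restr_supp_id.
  rewrite -(subrKA (v k)) -{2}vk -restr_suppB (le_trans (ler_normD _ _))//.
  rewrite [leRHS]splitr lerD ?(ltW kP)// (le_trans (restr_norm _ _))//.
  by rewrite distrC ltW.
by rewrite -[x](subrK y) restr_suppD Sx Sy.
Qed.

(* The upper estimate will come from smoothness, the
   lower one from the part of [x] that is disjoint from all the [s n]. *)
Definition extendable (X : submodClosed Lp) := exists c C : R, 0 < c /\ 0 < C /\
  forall s, (forall n, s n \in X) -> exists2 x, x \in X & forall l a,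
    `|comb s l| `^ p + c * `|a| `^ p <= `|comb s l + a *: x| `^ p
      <= `|comb s l| `^ p + C * `|a| `^ p.

(** Smoothness from above and convexity from below bound the increment by [K * |z|] once [|z| <= 1],
    where [|z| ^ p <= |z|]. *)
Lemma normp_continuous u (e : R) : p <= 2 -> 0 < e ->
  exists2 del : R, 0 < del & forall v, `|u - v| < del -> `| `|u| `^ p - `|v| `^ p| < e.
Proof.
move=> p2 e0; pose K : R := p * (`|u| `^ p + 1) + 2 * p.
have K0 : 0 < K by rewrite ltr_wpDl ?mulr_gt0// mulr_ge0 ?addr_ge0 ?powR_ge0// ltW.
exists (Num.min 1 (e / K)) => [|v].
  by rewrite lt_min ltr01 divr_gt0.
rewrite lt_min => /andP[uv1 uvK].
pose z := v - u; have vE : v = u + z by rewrite addrC subrK.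
have zuv : `|z| = `|u - v| by rewrite distrC.
have zp : `|z| `^ p <= `|z|.
  have [->|z0] := eqVneq z 0; first by rewrite normr0 powR0.
  by rewrite ge1r_powR// normr_gt0 z0 zuv ltW.
have H1 := normp_smooth u z p2.
have H2 : `|u| `^ p + grad u z <= `|u + z| `^ p.
  have idT : restr (@measurableT _ T) u = u.
    by apply: restr_id => t []; exact: I.
  by rewrite (le_trans _ (normp_gradient z idT))// lerDl powR_ge0.
have H3 := grad_norm u z.
rewrite vE; apply: (@le_lt_trans _ _ (K * `|z|)); last by rewrite mulrC -ltr_pdivlMr// zuv.
move: H3; rewrite !ler_norml /K => /andP[H3 H4].
have : 2 * p * `|z| `^ p <= 2 * p * `|z| by rewrite ler_pM2l// mulr_gt0.
have : 0 <= 2 * p * `|z| by rewrite !mulr_ge0// ltW.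
rewrite mulrDl; move: (2 * p * `|z|) => r r0 r1.
by apply/andP; split; lra.
Qed.

(** For a normalized kernel vector the gradient terms vanish at rational combinations:
    [normp_gradient] then gives the lower constant [e] and [normp_smooth] the upper constant
    [2 * p]. Continuity extends both to real combinations. *)
Lemma kernel_extendable (X : submodClosed Lp) (e : R) : p <= 2 -> 0 < e ->
  (forall s, (forall n, s n \in X) ->
    exists2 x, in_kernel X s x & e * `|x| `^ p < `|x - restr_supp s x| `^ p) ->
  extendable X.
Proof.
move=> p2 e0 H; exists e, (2 * p); split=> //; split; first by rewrite mulr_gt0.
move=> s sX; have [x0 [x0X x0k] x0e] := H s sX.
have x00 : x0 != 0.
  apply: contraTneq x0e => ->.
  by rewrite /restr_supp restr0 subrr normr0 powR0// mulr0 ltxx.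
pose x := `|x0|^-1 *: x0; have nx0 : 0 < `|x0| by rewrite normr_gt0.
have nx : `|x| = 1 by rewrite normrZ normfV normr_id mulVf// gt_eqF.
have xe : e <= `|x - restr_supp s x| `^ p.
  rewrite /x restr_suppZ -scalerBr normpZ normfV normr_id.
  rewrite -(@ler_pM2l _ (`|x0| `^ p)) ?powR_gt0//.
  rewrite mulrA -powRM ?invr_ge0// mulfV ?gt_eqF// powR1 mul1r mulrC.
  exact: ltW.
exists x => [|l a]; first exact: rpredZ.
have rat_case l' : `|rcomb s l'| `^ p + e * `|a| `^ p <= `|rcomb s l' + a *: x| `^ p
    <= `|rcomb s l'| `^ p + 2 * p * `|a| `^ p.
  have g0 : grad (rcomb s l') (a *: x) = 0 by rewrite !gradZ x0k !mulr0.
  apply/andP; split.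
    have us : restr (measurable_supp s) (rcomb s l') = rcomb s l'.
      by rewrite rcombE; exact: restr_comb.
    apply: le_trans (normp_gradient (a *: x) us).
    rewrite g0 addr0 lerD2l.
    have -> : a *: x - restr (measurable_supp s) (a *: x) = a *: (x - restr_supp s x).
      by rewrite scalerBr -restr_suppZ.
    by rewrite normpZ [leLHS]mulrC; apply: ler_wpM2l; rewrite ?powR_ge0.
  by have := normp_smooth (rcomb s l') (a *: x) p2; rewrite g0 addr0 normpZ nx powR1 mulr1.
have appr del : 0 < del -> exists l', `| `|comb s l| `^ p - `|rcomb s l'| `^ p| < del /\
    `| `|comb s l + a *: x| `^ p - `|rcomb s l' + a *: x| `^ p| < del.
  move=> del0; have [d1 d10 H1] := normp_continuous (comb s l) p2 del0.
  have [d2 d20 H2] := normp_continuous (comb s l + a *: x) p2 del0.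
  have d0 : 0 < Num.min d1 d2 by rewrite lt_min d10.
  have [l' ] := rcomb_approx s l d0; rewrite lt_min => /andP[h1 h2].
  exists l'; split; first exact: H1.
  by apply: H2; rewrite opprD addrACA subrr addr0.
apply/andP; split; apply/ler_addgt0Pr => del del0.
  have [|l' []] := appr (del / 2); first by rewrite divr_gt0.
  by rewrite !ltr_norml; have /andP[+ _] := rat_case l'; lra.
have [|l' []] := appr (del / 2); first by rewrite divr_gt0.
by rewrite !ltr_norml; have /andP[_ +] := rat_case l'; lra.
Qed.

Lemma extendable_or_supported (X : submodClosed Lp) : p < 2 -> closed [set` X] ->
  extendable X \/ exists2 s, (forall n, s n \in X) &
    exists C : R, forall x, x \in X -> `|x| <= C * `|restr_supp s x|.
Proof.
move=> p2 Xc; move: (p1'); rewrite le_eqVlt => /predU1P[pE|p1lt]; last first.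
  have [||[s sX sP]|[e e0 eP]] := @kernel_dichotomy X; rewrite ?p1lt ?(ltW p2)//.
    by right; exists s => //; exists 1 => x /sP ->; rewrite mul1r.
  by left; apply: (kernel_extendable (ltW p2) e0).
have pow1 (r : R) : 0 <= r -> r `^ p = r by move=> r0; rewrite -pE powRr1.
have [?|nS] := pselect (exists2 s, (forall n, s n \in X) &
    exists C : R, forall x, x \in X -> `|x| <= C * `|restr_supp s x|); first by right.
(* Now [p = 1]. Less than a third of the unit vector [x] lies on [supp s]; moving this part of
   [a *: x] aside costs under [|a| / 3] and the rest contributes over [2 * |a| / 3], a net gain of
   at least [|a| / 3]. *)
left; exists 3^-1, 1; do 2 split => //.
move=> s sX; have [x0 [x0X x0P]] : exists x, x \in X /\ 3 * `|restr_supp s x| < `|x|.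
  apply: contrapT => H; apply: nS; exists s => //; exists 3 => x xX.
  by rewrite leNgt; apply/negP => lt; apply: H; exists x.
have nx0 : 0 < `|x0| by rewrite (le_lt_trans _ x0P)// mulr_ge0.
pose x := `|x0|^-1 *: x0.
have nx : `|x| = 1 by rewrite normrZ normfV normr_id mulVf// gt_eqF.
have xP : 3 * `|restr_supp s x| < 1.
  rewrite /x restr_suppZ normrZ normfV normr_id mulrCA.
  by rewrite ltr_pdivrMl// mulr1.
exists x => [|l a]; first exact: rpredZ.
rewrite !pow1//; apply/andP; split; last first.
  by rewrite (le_trans (ler_normD _ _))// normrZ nx mulr1 mul1r.
have splitN v : `|v| = `|restr_supp s v| + `|v - restr_supp s v|.
  by have := restr_split (measurable_supp s) v; rewrite !pow1.
rewrite (splitN (comb s l + a *: x)) restr_suppD restr_suppZ.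
rewrite restr_comb opprD addrACA subrr add0r -scalerBr normrZ.
have := ler_normB (comb s l + a *: restr_supp s x) (a *: restr_supp s x).
rewrite addrK normrZ.
have := splitN x; rewrite nx.
have : `|a| * (3 * `|restr_supp s x|) <= `|a| * 1 by rewrite ler_wpM2l// ltW.
move: `|a| `|restr_supp s x| => A r h1 h2.
have -> : `|x - restr_supp s x| = 1 - r by rewrite h2; ring.
by lra.
Qed.

End extension_property.

(** * Unit vectors and extension by density *)

(** Coefficients of equal indices are added up. The new list depends on [l] only, so one list serves
    two families that are compared. *)
Lemma comb_uniq (R : realType) (I : eqType) (l : seq (R * I)) :
  exists2 l', uniq [seq k.2 | k <- l'] & forall (V : lmodType R) (s : I -> V),
    comb s l = comb s l'.
Proof.
pose A i := \sum_(k <- l | k.2 == i) k.1.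
exists [seq (A i, i) | i <- undup [seq k.2 | k <- l]].
  by rewrite -map_comp map_id undup_uniq.
move=> V s; rewrite /comb big_map /=.
under [RHS]eq_bigr do rewrite scaler_suml.
rewrite (exchange_big_dep predT)//= big_seq [RHS]big_seq; apply: eq_bigr => k kl.
have k2 : k.2 \in undup [seq j.2 | j <- l] by rewrite mem_undup map_f.
rewrite big_mkcond (bigD1_seq k.2) ?undup_uniq//= eqxx big1 ?addr0// => i ik.
by rewrite eq_sym (negbTE ik).
Qed.

(** * Extension of a bounded linear map from a dense span *)

Section extension.
Context (R : realType) (I : Type) (Y Z : normedModType R) (e : I -> Y) (x : I -> Z).
Variable K : R.
Hypothesis Zc : seq_complete Z.
Hypothesis xe : forall l, `|comb x l| <= K * `|comb e l|.
Hypothesis dense : forall u (r : R), 0 < r -> exists l, `|u - comb e l| < r.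

(** The closure of the relation between [comb e l] and [comb x l]; [graph_le] makes it single-valued
    and completeness makes it total. *)
Let graph u z := forall r : R, 0 < r -> exists l, `|u - comb e l| < r /\ `|z - comb x l| < r.

Let combB (V : normedModType R) (s : I -> V) l l' :
  comb s (l ++ [seq (-1 * k.1, k.2) | k <- l']) = comb s l - comb s l'.
Proof. by rewrite comb_cat combZ scaleN1r. Qed.

Let graph_le u z u' z' : graph u z -> graph u' z' -> `|z - z'| <= K * `|u - u'|.
Proof.
move=> gu gu'; apply/ler_addgt0Pr => r r0.
pose K' : R := `|K| + 1; have K'0 : 0 < K' by rewrite ltr_wpDl.
pose q := r / (2 * (1 + K')).
have q0 : 0 < q by rewrite divr_gt0// mulr_gt0// addr_gt0.
have [l [ul zl]] := gu _ q0; have [l' [ul' zl']] := gu' _ q0.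
have := xe (l ++ [seq (-1 * k.1, k.2) | k <- l']); rewrite !combB => H.
have zz : `|z - z'| <= `|comb x l - comb x l'| + 2 * q.
  have -> : z - z' = (comb x l - comb x l') + ((z - comb x l) - (z' - comb x l')).
    by rewrite opprB addrACA [comb x l + _]addrC subrK addKr.
  rewrite (le_trans (ler_normD _ _))// lerD2l (le_trans (ler_normB _ _))//; lra.
have uu : `|(comb e l - comb e l') - (u - u')| <= 2 * q.
  have -> : (comb e l - comb e l') - (u - u') = (u' - comb e l') - (u - comb e l).
    by rewrite !opprB addrACA [RHS]addrACA [comb e l + _]addrC.
  by rewrite (le_trans (ler_normB _ _))//; lra.
have : K * `|comb e l - comb e l'| <= K * `|u - u'| + K' * (2 * q).
  rewrite -lerBlDl -mulrBr (le_trans (ler_norm _))// normrM ler_pM//.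
    by rewrite /K' lerDl.
  exact: le_trans (ler_dist_dist _ _) uu.
have -> : r = 2 * q + K' * (2 * q).
  by rewrite /q; field; rewrite gt_eqF// addr_gt0.
lra.
Qed.

Let graph_ex u : exists z, graph u z.
Proof.
have H n : exists l, `|u - comb e l| < n.+1%:R^-1 by apply: dense; rewrite invr_gt0.
have [l lP] := choice H.
have [|z zP] := @Zc (fun n => comb x (l n)).
  apply: (@approx_cauchy _ _ _ K _ (fun n => comb e (l n)) u) => // m n.
  by rewrite -!combB.
exists z => r r0; have [n nP] := invS_small r0; have [m mP] := zP _ r0.
exists (l (maxn n m)); split; last by rewrite mP// leq_maxr.
by rewrite (lt_trans (lP _))// nP// leq_maxl.
Qed.

Let graph_linear a u z u' z' : graph u z -> graph u' z' ->
  graph (a *: u + u') (a *: z + z').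
Proof.
move=> gu gu' r r0; have r2 : 0 < r / 2 by rewrite divr_gt0.
have a0 : 0 < `|a| + 1 by rewrite ltr_wpDl.
have [l [ul zl]] := gu _ (divr_gt0 r2 a0); have [l' [ul' zl']] := gu' _ r2.
have H (V : normedModType R) (v v' w w' : V) : `|v - w| < r / 2 / (`|a| + 1) ->
    `|v' - w'| < r / 2 -> `|a *: v + v' - (a *: w + w')| < r.
  move=> vw vw'; rewrite opprD addrACA -scalerBr (le_lt_trans (ler_normD _ _))//.
  rewrite [ltRHS]splitr ltrD// normrZ (@le_lt_trans _ _ ((`|a| + 1) * `|v - w|))//.
    by rewrite ler_wpM2r// lerDl.
  by rewrite mulrC -ltr_pdivlMr.
exists ([seq (a * k.1, k.2) | k <- l] ++ l').
by rewrite !comb_cat !combZ; split; apply: H.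
Qed.

(** The closed graph is a linear function. The simultaneous approximation is kept in the conclusion
    because lower bounds also pass to the limit through it. *)
Lemma dense_extension : exists F : {linear Y -> Z},
  (forall u, `|F u| <= K * `|u|) /\
  forall u (r : R), 0 < r -> exists l, `|u - comb e l| < r /\ `|F u - comb x l| < r.
Proof.
have [F FP] := choice graph_ex.
have lF : linear F.
  move=> a u v; apply/eqP; rewrite -subr_eq0 -normr_le0.
  have := graph_le (FP (a *: u + v)) (graph_linear a (FP u) (FP v)).
  by rewrite subrr normr0 mulr0.
have [f fE] := linear_packed lF; exists f; split=> [u|u r r0]; rewrite fE; last exact: FP.
have g0 : graph 0 0 by move=> r r0; exists [::]; rewrite /comb !big_nil !subrr !normr0.
by have := graph_le (FP u) g0; rewrite !subr0.
Qed.

End extension.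

Section exhaustion.
Context d (T : measurableType d) (R : realType).
Variables (mu : {measure set T -> \bar R}) (p : R) (p1 : (1 <= p%:E)%E).
Local Notation Lp := (LspaceType mu p1).

Let p0 : 0 < p. Proof. by rewrite (lt_le_trans ltr01)// -lee_fin. Qed.
Let pN0 : p != 0. Proof. by rewrite gt_eqF. Qed.

(** Monotone convergence gives the norms of the restrictions, and by [restr_split] their deficit is
    the norm of the residue. *)
Lemma restr_exhaust (A : nat -> set T) (mA : forall n, measurable (A n)) (u : Lp) (e : R) :
  (forall n m, (n <= m)%N -> A n `<=` A m) ->
  (forall t, Lrepr u t != 0 -> exists n, A n t) ->
  0 < e -> exists n, `|u - restr (mA n) u| `^ p < e.
Proof.
move=> Asub Au e0; pose f := Lfun_of u; pose F t : \bar R := (`|f t| `^ p)%:E.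
have mf := measurable_Lfun f.
have FA n t : (`|\1_(A n) t * f t| `^ p)%:E = (\1_(A n) t * `|f t| `^ p)%:E.
  by rewrite normp_indic.
have cv : (\int[mu]_t (`|\1_(A n) t * f t| `^ p)%:E)%E @[n --> \oo] --> (\int[mu]_t F t)%E.
  rewrite [X in _ --> X](_ : _ =
      \int[mu]_t limn (fun n => (`|\1_(A n) t * f t| `^ p)%:E))%E.
    apply: cvg_monotone_convergence => //.
    - move=> n; apply/measurable_EFinP; apply: measurable_norm_powR.
      by apply: measurable_funM => //; exact: measurable_indic.
    - move=> t _ a b ab; rewrite !FA lee_fin ler_wpM2r ?powR_ge0//.
      rewrite !indicE; have [ta|//] := boolP (t \in A a).
      by rewrite mem_set//; apply: (Asub a) => //; rewrite inE in ta.
  apply: eq_integral => t _; apply/esym/cvg_lim => //.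
  have [ft0|ft0] := eqVneq (f t) 0.
    rewrite /F (_ : (fun n => _) = fun=> (`|f t| `^ p)%:E); first exact: cvg_cst.
    by apply/funext => n; rewrite ft0 mulr0.
  have [n nP] := Au t ft0.
  apply: cvg_near_cst; exists n => // m /= nm; rewrite FA indicE mem_set ?mul1r//.
  exact: (Asub n).
have e1 n : (`|restr (mA n) u| `^ p)%:E = (\int[mu]_t (`|\1_(A n) t * f t| `^ p)%:E)%E.
  by rewrite normp_mulL.
have e2 : (`|u| `^ p)%:E = (\int[mu]_t F t)%E by rewrite -normp_Lclass_EFin Lfun_ofK.
have rcv : `|restr (mA n) u| `^ p @[n --> \oo] --> `|u| `^ p.
  have : (`|restr (mA n) u| `^ p)%:E @[n --> \oo] --> (`|u| `^ p)%:E.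
    by rewrite e2; under eq_fun do rewrite e1.
  by move/fine_cvg.
move/cvgrPdist_lt : rcv => /(_ _ e0)[n _ nP]; exists n.
have := nP n (leqnn n); rewrite (restr_split (mA n) u).
by rewrite addrAC subrr add0r ger0_norm ?powR_ge0.
Qed.

End exhaustion.

Section unit_vectors.
Context (R : realType) (p : R) (p1 : (1 <= p%:E)%E) (G : pointedType).
Local Notation D := (discrete_type G).
Local Notation mu := (counting : {measure set D -> \bar R}).
Local Notation Lp := (LspaceType mu p1).

Let p1' : 1 <= p. Proof. by rewrite -lee_fin. Qed.
Let p0 : 0 < p. Proof. by rewrite (lt_le_trans _ p1'). Qed.
Let pN0 : p != 0. Proof. by rewrite gt_eqF. Qed.

Let mD (A : set D) : measurable A. Proof. by []. Qed.

Let counting1 (g : D) : mu [set g] = 1%:E.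
Proof.
rewrite -[LHS]/(counting _) /counting asboolT; last exact: finite_set1.
by rewrite fset_set1 finmap.cardfs1.
Qed.

Let unit_subproof (g : D) : \1_[set g] \in Lfun mu p%:E.
Proof.
apply: mem_Lfun => //.
under eq_integral do rewrite -[\1__ _]mulr1 normp_indic// normr1 powR1 mulr1.
by rewrite integral_indic// setIT counting1 ltry.
Qed.

Definition ell_unit (g : D) : Lp := Lclass (Lfun_Sub p1 (unit_subproof g)).

Lemma normp_unit g : `|ell_unit g| `^ p = 1.
Proof.
apply/EFin_inj; rewrite normp_Lclass_EFin.
under eq_integral do rewrite -[X in `|X|]mulr1 normp_indic// normr1 powR1 mulr1.
by rewrite integral_indic// setIT counting1.
Qed.

Lemma restr_unit A g :
  restr (mD A) (ell_unit g) = if g \in A then ell_unit g else 0.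
Proof.
rewrite /restr mulLE -[0](_ : Lclass 0 = 0); last first.
  by apply: (@addrI _ (Lclass 0)); rewrite -LclassD !addr0.
have unit0 h : h != g -> \1_[set g] h = 0 :> R.
  by move=> hg; rewrite indicE memNset// => /eqP; rewrite (negbTE hg).
case: ifPn => gA; congr Lclass; apply/LfuneqP => h /=.
  have [->|hg] := eqVneq h g; last by rewrite unit0// mulr0.
  by rewrite [X in X * _]indicE gA mul1r.
have [->|hg] := eqVneq h g; last by rewrite unit0// mulr0.
by rewrite [X in X * _]indicE (negbTE gA) mul0r.
Qed.

(** Induction: restriction to the singleton of the first index splits off one term, as that index
    does not recur. *)
Lemma normp_comb_unit (l : seq (R * D)) : uniq [seq k.2 | k <- l] ->
  `|comb ell_unit l| `^ p = \sum_(k <- l) `|k.1| `^ p.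
Proof.
elim: l => [_|k l ih]; first by rewrite /comb !big_nil normr0 powR0.
rewrite map_cons cons_uniq => /andP[kl ul].
rewrite comb_cons big_cons -ih// (restr_split (mD [set k.2])) restrD restrZ restr_unit.
rewrite mem_set//.
have -> : restr (mD [set k.2]) (comb ell_unit l) = 0.
  elim: l kl {ih ul} => [_|j l ih]; first by rewrite /comb big_nil restr0.
  rewrite map_cons inE negb_or => /andP[kj kl].
  rewrite comb_cons restrD restrZ restr_unit memNset ?scaler0 ?add0r ?ih//=.
  by move=> jk; rewrite jk eqxx in kj.
by rewrite addr0 addrAC subrr add0r normpZ normp_unit mulr1.
Qed.

Lemma restr_finite (s : seq D) (u : Lp) : uniq s ->
  restr (mD [set` s]) u = comb ell_unit [seq (Lrepr u g, g) | g <- s].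
Proof.
elim: s => [_|g s ih /andP[gs us]].
  rewrite /comb big_nil -[0](_ : Lclass 0 = 0); last first.
    by apply: (@addrI _ (Lclass 0)); rewrite -LclassD !addr0.
  congr Lclass; apply/LfuneqP => t /=.
  by rewrite indicE memNset ?mul0r.
rewrite map_cons comb_cons -ih//= /ell_unit -LclassZ -LclassD.
congr Lclass; apply/LfuneqP => t.
transitivity (Lrepr u g * \1_[set g] t + \1_[set` s] t * Lrepr u t); last by [].
transitivity (\1_[set` g :: s] t * Lrepr u t); first by [].
have [->|tg] := eqVneq t g.
  have -> : \1_[set` g :: s] g = 1 :> R by rewrite indicE mem_set//= mem_head.
  have -> : \1_[set g] g = 1 :> R by rewrite indicE mem_set.
  have -> : \1_[set` s] g = 0 :> R by rewrite indicE memNset//=; exact/negP.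
  by rewrite mulr1 mul1r mul0r addr0.
have -> : \1_[set g] t = 0 :> R by rewrite indicE memNset//; apply/eqP.
rewrite mulr0 add0r; congr (_ * _); rewrite !indicE; congr (nat_of_bool _)%:R.
by apply/idP/idP; rewrite !inE/= inE (negbTE tg).
Qed.

(* Only finitely many entries of a summable family exceed [1 / n]. *)
Lemma comb_unit_dense (u : Lp) (r : R) : 0 < r -> exists l, `|u - comb ell_unit l| < r.
Proof.
move=> r0; pose f := Lfun_of u.
pose A n : set D := [set t | n.+1%:R^-1 <= `|f t| `^ p].
have IF : (\int[mu]_t (`|f t| `^ p)%:E < +oo)%E by rewrite -normp_Lclass_EFin ltry.
have finA n : finite_set (A n).
  apply: contrapT => infA.
  have : (n.+1%:R^-1%:E * mu (A n) <= \int[mu]_t (`|f t| `^ p)%:E)%E.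
    rewrite -[A n]setIT -integral_indic// -ge0_integralZl_EFin//.
    apply: ge0_le_integral => // t _; rewrite -EFinM lee_fin indicE.
    have [|_] := boolP (t \in A n); last by rewrite mulr0 powR_ge0.
    by rewrite inE mulr1.
  rewrite -[mu _]/(counting _) /counting asboolF// gt0_muley ?lte_fin ?invr_gt0//.
  by rewrite leye_eq => /eqP IFE; rewrite IFE ltxx in IF.
have rp0 : 0 < r `^ p by rewrite powR_gt0.
have [|t ft0|n nP] := @restr_exhaust _ _ _ mu p p1 A (fun n => mD (A n)) u _ _ _ rp0.
- by move=> a b ab t; apply: le_trans; rewrite lef_pV2 ?posrE// ler_nat.
- have [|n nP] := @invS_small _ (`|f t| `^ p); first by rewrite powR_gt0 ?normr_gt0.
  by exists n; rewrite /A/= ltW// nP.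
pose s := finmap.enum_fset (fset_set (A n)).
exists [seq (Lrepr u g, g) | g <- s].
rewrite -restr_finite; last exact: finmap.fset_uniq.
have sE t : (t \in s) = (t \in A n) by exact: in_fset_set.
have sA : [set` s] = A n by apply/seteqP; split=> t /=; rewrite sE inE.
apply: normp_lt => //.
have -> // : restr (mD [set` s]) u = restr (mD (A n)) u.
by congr Lclass; apply/LfuneqP => t /=; rewrite sA.
Qed.

End unit_vectors.

(** * Embedding the sequence space *)

Lemma powR_root_le (R : realType) (p a b C : R) : 0 < p -> 0 <= a -> 0 <= b -> 0 <= C ->
  a `^ p <= C * b `^ p -> a <= C `^ p^-1 * b.
Proof.
move=> p0 a0 b0 C0 H; have pN0 : p != 0 by rewrite gt_eqF.
rewrite -(powRKV pN0 a0) -[in leRHS](powRKV pN0 b0) -powRM ?powR_ge0//.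
by rewrite ge0_ler_powR ?invr_ge0 ?(ltW p0) ?nnegrE ?mulr_ge0 ?powR_ge0.
Qed.

Section ell_subspace.
Context d (T : measurableType d) (R : realType).
Variables (nu : {measure set T -> \bar R}) (p : R) (p1 : (1 <= p%:E)%E).
Local Notation Lp := (LspaceType nu p1).
Variable X : submodClosed Lp.

Let p1' : 1 <= p. Proof. by rewrite -lee_fin. Qed.
Let p0 : 0 < p. Proof. by rewrite (lt_le_trans _ p1'). Qed.
Let pN0 : p != 0. Proof. by rewrite gt_eqF. Qed.

(** Stated for a set of vectors, not a family, so that inclusion orders these sets for Zorn's
    lemma. *)
Definition ell_like (c C : R) (S : set Lp) := forall l : seq (R * Lp),
  uniq [seq k.2 | k <- l] -> (forall k, k \in l -> S k.2) ->
  c * \sum_(k <- l) `|k.1| `^ p <= `|comb id l| `^ p <= C * \sum_(k <- l) `|k.1| `^ p.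

(** The condition concerns finite lists, and a finite list from the union of a chain lies in a
    single member. *)
Lemma ell_like_bigcup c C (F : set (set Lp)) :
  (forall S, F S -> ell_like c C S) -> total_on F subset -> ell_like c C (\bigcup_(S in F) S).
Proof.
move=> Fl Ft l ul lS.
have [->|[S FS lSS]] : l = [::] \/ exists2 S, F S & forall k, k \in l -> S k.2.
  elim: l lS {ul} => [|k l ih] lS; [by left|right].
  have [S FS Sk] := lS k (mem_head _ _).
  have [|->|[S' FS' S'l]] := ih.
  - by move=> j jl; apply: lS; rewrite inE jl orbT.
  - by exists S => // j; rewrite inE => /eqP ->.
  - have [SS'|S'S] := Ft _ _ FS FS'.
      by exists S' => // j; rewrite inE => /predU1P[->|/S'l//]; exact: SS'.
    by exists S => // j; rewrite inE => /predU1P[->//|/S'l/S'S].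
  by rewrite /comb !big_nil normr0 powR0// !mulr0 lexx.
exact: Fl FS _ ul lSS.
Qed.

(** A maximal [ell_like] subset cannot be countable: enumerating it, the extension property yields a
    new vector that can be added with the same constants. *)
Lemma uncountable_ell_like : extendable X -> exists c C : R, 0 < c /\ 0 < C /\
  exists S, [/\ S `<=` [set` X], ell_like c C S & ~ countable S].
Proof.
move=> [c [C [c0 [C0 ext]]]]; exists c, C; do 2 split => //.
have [S [[SX Sl] Smax]] : exists S, (S `<=` [set` X] /\ ell_like c C S) /\
    forall B, S `<` B -> ~ (B `<=` [set` X] /\ ell_like c C B).
  apply: (@Zorn_bigcup _ (fun S => S `<=` [set` X] /\ ell_like c C S)) => F FP Ft.
  split; last by apply: ell_like_bigcup => // S /FP[].
  by move=> v [S /FP[SX _] /SX].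
exists S; split => // /countable_injP[f finj].
have [s sS] : exists s : nat -> Lp, (forall n, s n \in X) /\ forall v, S v -> s (f v) = v.
  pose s n := if pselect (exists2 v, S v & f v = n) is left H then s2val (cid2 H) else 0.
  exists s; split=> [n|v Sv]; rewrite /s; case: pselect => [H|nH].
  - by case: (cid2 H) => v /= /SX.
  - exact: rpred0.
  - by case: (cid2 H) => v' /= Sv' fv; apply: finj; rewrite ?inE.
  - by case: nH; exists v.
have [x xX xP] := ext s sS.1.
have combE l : (forall k, k \in l -> S k.2) ->
    comb id l = comb s [seq (k.1, f k.2) | k <- l].
  move=> lS; rewrite comb_map /comb big_seq [RHS]big_seq.
  by apply: eq_bigr => k kl; rewrite /= sS.2//; exact: lS.
(* Otherwise [x - x] would have norm power at least [|x| ^ p + c > 0]. *)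
have nSx : ~ S x.
  move=> Sx; have := xP [:: (1, f x)] (-1).
  rewrite comb_cons /comb big_nil addr0 /= sS.2// scale1r scaleN1r subrr.
  rewrite normr0 normrN normr1 powR1 powR0// mulr1 => /andP[H _].
  by move: H; apply/negP; rewrite -ltNge ltr_wpDl ?powR_ge0.
apply: (Smax (S `|` [set x])).
  split; first by move=> v Sv; left.
  by move=> H; apply: nSx; apply: H; right.
split=> [v [/SX//|->//]|l ul lS].
have [xl|nxl] := boolP (x \in [seq k.2 | k <- l]); last first.
  apply: Sl => // k kl; have [//|kx] := lS k kl.
  by rewrite -kx map_f in nxl.
have [k kl xk] := mapP xl.
have pl := perm_to_rem kl.
have := perm_map snd pl; move=> /perm_uniq; rewrite ul => /esym/=/andP[nk ur].
have rS j : j \in rem k l -> S j.2.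
  move=> jr; have [//|jx] := lS j (mem_rem jr).
  by rewrite -xk -jx map_f in nk.
rewrite (perm_comb _ pl) (perm_big _ pl)/= comb_cons big_cons -xk [_ *: _ + _]addrC.
have /andP[l1 l2] := Sl _ ur rS.
have := xP [seq (j.1, f j.2) | j <- rem k l] k.1; rewrite -combE// => /andP[h1 h2].
by rewrite !mulrDr; apply/andP; split; lra.
Qed.

(** By minimality of aleph_1, [G] injects into an uncountable [ell_like] set; sending unit vectors
    to its elements is bounded above and below on combinations, hence on their closure. *)
Lemma ell_embeds (G : pointedType) : card_aleph1 [set: G] -> closed [set` X] ->
  extendable X -> embeds_isomorphically (ell p1 G) (subspace_type X).
Proof.
move=> [_ G1] Xc /uncountable_ell_like[c [C [c0 [C0 [S [SX Sl nS]]]]]].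
have /card_leP[i0] := G1 _ _ nS.
pose i (g : G) : Lp := val (i0 (exist _ g (mem_set (I : [set: G] g)))).
have iS g : S (i g) by apply: set_mem; exact: valP.
have i_inj : injective i.
  move=> g h /val_inj /(@inj _ _ _ i0 _ _ (mem_set I) (mem_set I)) gh.
  by case: gh.
have iX g : i g \in X by exact: SX.
pose x g : subspace_type X := exist _ (i g) (iX g).
have vx l : val (comb x l) = comb id [seq (k.1, i k.2) | k <- l].
  by rewrite comb_map /comb raddf_sum; apply: eq_bigr => k _.
have xl (l : seq (R * G)) : uniq [seq k.2 | k <- l] ->
    c * `|comb (ell_unit p1 (G := G)) l| `^ p <= `|comb x l| `^ p <=
    C * `|comb (ell_unit p1 (G := G)) l| `^ p.
  move=> ul; rewrite normp_comb_unit// -[`|comb x l|]/(`|val (comb x l)|) vx.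
  have := Sl [seq (k.1, i k.2) | k <- l]; rewrite big_map/=; apply.
    by rewrite -map_comp (_ : _ \o _ = i \o snd)// map_comp (map_inj_uniq i_inj).
  by move=> _ /mapP[k _ ->]; exact: iS.
have Ci : 0 <= C `^ p^-1 by rewrite powR_ge0.
have upper l : `|comb x l| <= C `^ p^-1 * `|comb (ell_unit p1 (G := G)) l|.
  have [l' ul' lE] := comb_uniq l; rewrite !lE.
  by apply: powR_root_le => //; [exact: ltW|case/andP: (xl _ ul')].
have lower l : `|comb (ell_unit p1 (G := G)) l| <= c^-1 `^ p^-1 * `|comb x l|.
  have [l' ul' lE] := comb_uniq l; rewrite !lE.
  apply: powR_root_le => //; first by rewrite invr_ge0 ltW.
  by rewrite ler_pdivlMl//; case/andP: (xl _ ul').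
have [F [Fu Fd]] := dense_extension (subspace_complete (@Lspace_complete _ _ _ _ _ _) Xc)
  upper (@comb_unit_dense R p p1 G).
(* An approximation within [e / (1 + K)] on both sides turns the lower bound on combinations into
   one on [u] up to [e]. *)
have Fl u : `|u| <= c^-1 `^ p^-1 * `|F u|.
  pose K := c^-1 `^ p^-1; have K0 : 0 <= K by exact: powR_ge0.
  apply/ler_addgt0Pr => e e0; have q0 : 0 < e / (1 + K) by rewrite divr_gt0// ltr_wpDr.
  have [l [h1 h2]] := Fd u _ q0.
  have h3 : `|u| <= `|u - comb (ell_unit p1 (G := G)) l| + `|comb (ell_unit p1 (G := G)) l|.
    by rewrite -[in leLHS](subrK (comb (ell_unit p1 (G := G)) l) u) ler_normD.
  have h4 : `|comb x l| <= `|F u| + `|F u - comb x l|.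
    by rewrite -[in leLHS](subKr (F u) (comb x l)) ler_normB.
  have h5 := lower l.
  have h6 := ler_wpM2l K0 h4.
  have h7 := ler_wpM2l K0 (ltW h2).
  have -> : e = e / (1 + K) + K * (e / (1 + K)) by field; rewrite gt_eqF// ltr_wpDr.
  by move: h5 h6 h7; rewrite -/K mulrDr; lra.
exists F; split; [by eexists; exact: Fu|by eexists; exact: Fl|].
apply: closed_range; [exact: Lspace_complete|by eexists; exact: Fu|by eexists; exact: Fl].
Qed.

End ell_subspace.

(** * Finite measures *)

Section bounded_functions.
Context d (T : measurableType d) (R : realType).
Variables (mu : {finite_measure set T -> \bar R}).

Let integrable_bounded (F : T -> R) b : measurable_fun setT F -> (forall t, `|F t| <= b) ->
  mu.-integrable setT (EFin \o F).
Proof.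
move=> mF Fb; have I := @finite_measure_integrable_cst _ _ _ mu setT b measurableT.
apply: (le_integrable _ _ _ I) => //; first exact/measurable_EFinP.
by move=> t _; rewrite /= lee_fin (le_trans (Fb t))// ler_norm.
Qed.

Let integrable_sqr (F : T -> R) b : measurable_fun setT F -> (forall t, `|F t| <= b) ->
  mu.-integrable setT (EFin \o (fun t => F t ^+ 2)).
Proof.
move=> mF Fb; apply: (@integrable_bounded _ (b ^+ 2)) => [|t].
  exact: measurable_funX.
by rewrite normrX lerXn2r// nnegrE// (le_trans _ (Fb t)).
Qed.

(** Bounded functions on a finite measure are square integrable, so the pointwise identity
    integrates. It supplies the average over two signs. *)
Lemma Rintegral_parallelogram (F g : T -> R) b : measurable_fun setT F ->
  measurable_fun setT g -> (forall t, `|F t| <= b) -> (forall t, `|g t| <= b) ->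
  \int[mu]_t (F t + g t) ^+ 2 + \int[mu]_t (F t - g t) ^+ 2 =
  2 * (\int[mu]_t (F t) ^+ 2 + \int[mu]_t (g t) ^+ 2).
Proof.
move=> mF mg Fb gb.
have I1 : mu.-integrable setT (EFin \o (fun t => (F t + g t) ^+ 2)).
  apply: (@integrable_sqr _ (b + b)); first exact: measurable_funD.
  by move=> t; rewrite (le_trans (ler_normD _ _))// lerD.
have I2 : mu.-integrable setT (EFin \o (fun t => (F t - g t) ^+ 2)).
  apply: (@integrable_sqr _ (b + b)); first exact: measurable_funB.
  by move=> t; rewrite (le_trans (ler_normB _ _))// lerD.
have I3 := integrable_sqr mF Fb; have I4 := integrable_sqr mg gb.
have I5 : mu.-integrable setT (EFin \o (fun t => F t ^+ 2 + g t ^+ 2)).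
  exact: (integrableD measurableT I3 I4).
rewrite -!RintegralD// -RintegralZl//; apply: eq_Rintegral => t _; ring.
Qed.

Lemma Rintegral_sqr_le (g : T -> R) b : measurable_fun setT g ->
  (forall t, `|g t| <= b) -> \int[mu]_t (g t) ^+ 2 <= b ^+ 2 * fine (mu setT).
Proof.
move=> mg gb; rewrite -Rintegral_cst//; apply: le_Rintegral => //.
- exact: (integrable_sqr mg gb).
- exact: finite_measure_integrable_cst.
- move=> t _; rewrite -(real_normK (num_real (g t))) lerXn2r// nnegrE//.
  exact: le_trans (gb t).
Qed.

Lemma Rintegral_powR_le_sqr (p : R) (F : T -> R) b s C : measurable_fun setT F ->
  mu.-integrable setT (EFin \o (fun t => `|F t| `^ p)) ->
  (forall t, `|F t| <= b) -> (forall x : R, `|x| `^ p <= s * x ^+ 2 + C) ->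
  \int[mu]_t (`|F t| `^ p) <= s * (\int[mu]_t (F t) ^+ 2) + C * fine (mu setT).
Proof.
move=> mF IF Fb sC; have I := integrable_sqr mF Fb.
have I1 : mu.-integrable setT (EFin \o (fun t => s * F t ^+ 2)).
  exact: (integrableZl measurableT s I).
have I2 : mu.-integrable setT (EFin \o (fun=> C)) by exact: finite_measure_integrable_cst.
rewrite -Rintegral_cst// -RintegralZl// -RintegralD//; apply: le_Rintegral => //.
exact: (integrableD measurableT I1 I2).
Qed.

End bounded_functions.

(** * No embedding of an uncountable [ell_p] for a finite measure *)

Section necessity.
Context d (T : measurableType d) (R : realType).
Variables (mu : {finite_measure set T -> \bar R}) (p : R) (p1 : (1 <= p%:E)%E).
Hypothesis p2 : p < 2.
Local Notation Lp := (LspaceType mu p1).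
Local Notation Lf := (LfunType mu p1).

Let p1' : 1 <= p. Proof. by rewrite -lee_fin. Qed.
Let p0 : 0 < p. Proof. by rewrite (lt_le_trans _ p1'). Qed.
Let pN0 : p != 0. Proof. by rewrite gt_eqF. Qed.

Let A (v : Lp) (M : nat) := [set t | `|Lrepr v t| <= M%:R].

Let mA v M : measurable (A v M).
Proof.
rewrite (_ : A v M = (fun t => `|Lrepr v t|) @^-1` `]-oo, M%:R]); last first.
  by apply/seteqP; split=> t; rewrite /= in_itv.
rewrite -[_ @^-1` _]setTI.
have mv : measurable_fun setT (fun t => `|Lrepr v t|).
  by apply: measurableT_comp => //; exact: measurable_Lrepr.
exact: mv.
Qed.

Let trunc v M : Lf := mul_Lfun (p1 := p1) (measurable_indic (mA v M))
  (@indic_contraction _ _ _ mu p p1 _ (mA v M)) (Lfun_of v).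

Let trunc_bound v M t : `|trunc v M t| <= M%:R.
Proof.
rewrite -[trunc v M t]/(\1_(A v M) t * Lrepr v t) indicE.
have [|_] := boolP (t \in A v M); last by rewrite mul0r normr0.
by rewrite inE mul1r.
Qed.

Let trunc_approx v (e : R) : 0 < e -> exists M, `|v - Lclass (trunc v M)| `^ p < e.
Proof.
apply: (@restr_exhaust _ _ _ _ _ _ (A v) (mA v)) => [n m nm t|t _].
  by rewrite /A/= => /le_trans; apply; rewrite ler_nat.
exists (Num.truncn `|Lrepr v t|).+1; rewrite /A/= ltW//; exact: truncnS_gt.
Qed.

(* Signs chosen one at a time keep a combination of the square integral of the
   truncated parts and of the [p]-th power of the remainders of linear growth:
   for a fixed past, the average over the two signs does. *)
Let signs (I : eqType) (u : I -> Lp) M (del : R) (s : seq I) : 0 < del ->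
  (forall i, i \in s -> `|u i - Lclass (trunc (u i) M)| `^ p < del) ->
  exists l (F : Lf) (H : Lp), [/\ [seq k.2 | k <- l] = s,
    forall k, k \in l -> `|k.1| = 1 :> R, comb u l = Lclass F + H,
    exists b, forall t, `|F t| <= b &
    (M%:R ^+ 2 * fine (mu setT) + 1)^-1 * \int[mu]_t (F t) ^+ 2 +
      (2 * p * del)^-1 * `|H| `^ p <= 2 * (size s)%:R].
Proof.
(* [al] and [be] are scaled so that a new truncated part and a new remainder each contribute at most
   1 to the average over signs. *)
move=> del0; set al := _^-1; set be := _^-1.
have m0 : 0 <= fine (mu setT) by rewrite fine_ge0.
have al0 : 0 < al by rewrite invr_gt0 ltr_wpDl// mulr_ge0// sqr_ge0.
have be0 : 0 < be by rewrite invr_gt0 !mulr_gt0.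
elim: s => [_|i s ihs udel].
  exists [::], 0, 0; split => //.
  - rewrite /comb big_nil addr0.
    by apply: (@addrI _ (Lclass (0 : Lf))); rewrite -LclassD !addr0.
  - by exists 0 => t; rewrite normr0.
  - rewrite normr0 powR0// !mulr0 addr0 (_ : \int[mu]_t _ = 0) ?mulr0//.
    rewrite (_ : (fun t => _) = cst 0); first by rewrite Rintegral_cst// mul0r.
    by apply/funext => t; rewrite /= expr0n.
have [|l [F [H [ls l1 lFH [b Fb] ih]]]] := ihs.
  by move=> j js; apply: udel; rewrite inE js orbT.
set g := trunc (u i) M; set h := u i - Lclass g.
have ui : u i = Lclass g + h by rewrite addrC subrK.
have gb t : `|g t| <= Num.max b M%:R by rewrite le_max trunc_bound orbT.
have Fb' t : `|F t| <= Num.max b M%:R by rewrite le_max Fb.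
have mF := measurable_Lfun F; have mg := measurable_Lfun g.
have Q := Rintegral_parallelogram mu mF mg Fb' gb.
have Qg : al * \int[mu]_t (g t) ^+ 2 <= 1.
  rewrite ler_pdivrMl ?mulr1; last by rewrite ltr_wpDl// mulr_ge0// sqr_ge0.
  by rewrite (le_trans (Rintegral_sqr_le mu mg (trunc_bound _ _)))// lerDl.
have N1 := normp_smooth H h (ltW p2).
have N2 := normp_smooth H (- h) (ltW p2).
rewrite -scaleN1r gradZ scaleN1r normrN in N2.
have Nh : be * (2 * p * `|h| `^ p) <= 1.
  rewrite ler_pdivrMl ?mulr1; last by rewrite !mulr_gt0.
  by rewrite ler_pM2l ?mulr_gt0// ltW// udel// mem_head.
have NN : be * `|H + h| `^ p + be * `|H - h| `^ p <= 2 * (be * `|H| `^ p) + 2.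
  rewrite -mulrDr; apply: (@le_trans _ _ (be * (2 * `|H| `^ p + 2 * (2 * p * `|h| `^ p)))).
    by rewrite ler_pM2l//; lra.
  by rewrite mulrDr !(mulrCA be 2); lra.
have QQ : al * \int[mu]_t (F t + g t) ^+ 2 + al * \int[mu]_t (F t - g t) ^+ 2 <=
    2 * (al * \int[mu]_t (F t) ^+ 2) + 2.
  by rewrite -mulrDr Q mulrCA mulrDr; lra.
have sz : 2 * (size (i :: s))%:R = 2 * (size s)%:R + 2 :> R.
  by rewrite /= -(natr1 (size s)) mulrDr mulr1.
(* The two signs together give at most twice the previous value plus 4, so one of them adds at most
   2. *)
have [|ge] := lerP (al * \int[mu]_t (F t + g t) ^+ 2 + be * `|H + h| `^ p)
    (2 * (size (i :: s))%:R) => [le|].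
  exists ((1, i) :: l), (F + g), (H + h); split => //.
  - by rewrite /= ls.
  - by move=> k; rewrite inE => /predU1P[->|/l1//]; rewrite normr1.
  - rewrite comb_cons/= lFH scale1r ui LclassD [Lclass F + _ in RHS]addrC.
    by rewrite [H + _]addrC addrACA.
  - exists (b + M%:R) => t.
    exact: (le_trans (ler_normD (F t) (g t)) (lerD (Fb t) (trunc_bound _ _ _))).
exists ((-1, i) :: l), (F - g), (H - h); split => //.
- by rewrite /= ls.
- by move=> k; rewrite inE => /predU1P[->|/l1//]; rewrite normrN normr1.
- rewrite comb_cons/= lFH scaleN1r ui LclassB opprD [Lclass F - _]addrC.
  by rewrite [H - _]addrC addrACA.
- exists (b + M%:R) => t.
  exact: (le_trans (ler_normB (F t) (g t)) (lerD (Fb t) (trunc_bound _ _ _))).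
- move: ge; rewrite sz.
  have : (fun t => (F - g) t ^+ 2) = (fun t => (F t - g t) ^+ 2) by [].
  move=> ->; lra.
Qed.

(** For [n] unit vectors the lower bound forces [n <= ka * (|F| ^ p + |H| ^ p)]. The right side is
    below [n]: the remainder gives [n / 4], the quadratic part of [F] another [n / 4], and the
    constant part less than [n / 2]. *)
Lemma no_ell_embedding (G : pointedType) (f : {linear ell p1 G -> Lp}) (K : R) :
  ~ countable [set: G] -> ~ (forall u, `|u| <= K * `|f u|).
Proof.
move=> nG fK; pose e := @ell_unit R p p1 G; pose u g := f (e g).
pose K' : R := `|K| + 1; have K'0 : 0 < K' by rewrite ltr_wpDl.
(* [ka] comes from [|F + H| <= 2 * max |F| |H|], raised to the power [p]. *)
pose ka : R := (2 * K') `^ p; have ka0 : 0 < ka by rewrite powR_gt0// mulr_gt0.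
pose del : R := (16 * p * ka)^-1; have del0 : 0 < del by rewrite invr_gt0 !mulr_gt0.
have [M MP] := choice (fun g => trunc_approx (u g) del0).
(* Pigeonhole: countably many truncation heights for uncountably many vectors, so some height serves
   infinitely many. *)
have [N infN] : exists N, infinite_set [set g | M g = N].
  apply: contrapT => H; apply: nG.
  rewrite (_ : [set: G] = \bigcup_N [set g | M g = N]); last first.
    by apply/seteqP; split=> // g _; exists (M g).
  apply: bigcup_countable => // N _; apply: finite_set_countable.
  by apply: contrapT => nf; apply: H; exists N.
pose al := (N%:R ^+ 2 * fine (mu setT) + 1)^-1 : R.
have m0 : 0 <= fine (mu setT) by rewrite fine_ge0.
have al0 : 0 < al by rewrite invr_gt0 ltr_wpDl// mulr_ge0// sqr_ge0.
pose s : R := al / (8 * ka); have s0 : 0 < s by rewrite divr_gt0// mulr_gt0.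
have p02 : 0 < p < 2 by rewrite p0.
have [C C0 CP] := powR_le_sqr p02 s0.
(* [C] depends on [N] through [s] but not on the number of vectors, so [n] can be chosen afterwards
   to dominate the constant term. *)
pose n := (Num.truncn (2 * ka * (C * fine (mu setT)))).+1.
have [B BN Bn] := infinite_set_fset n infN.
have [|l [F [H [ls l1 lFH [b Fb] bnd]]]] :=
    @signs _ u N del (finmap.enum_fset B) del0.
  by move=> g gB; have <- : M g = N by exact: BN.
have size_l : size l = size (finmap.enum_fset B) by rewrite -ls size_map.
pose ns : R := (size l)%:R.
have nbig : 2 * ka * (C * fine (mu setT)) < ns.
  by rewrite (lt_le_trans (truncnS_gt _))// ler_nat size_l.
have ns_l : `|comb e l| `^ p = ns.
  rewrite normp_comb_unit; last by rewrite ls finmap.fset_uniq.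
  rewrite (eq_big_seq (fun=> 1)); last by move=> k /l1 ->; rewrite powR1.
  by rewrite big_const_seq count_predT iter_addr addr0.
have fl : f (comb e l) = comb u l.
  by rewrite /comb linear_sum; apply: eq_bigr => k _; rewrite linearZ.
have nsF : ns <= ka * (`|Lclass F| `^ p + `|H| `^ p).
  pose m := Num.max `|Lclass F| `|H|; have mge : 0 <= m by rewrite le_max normr_ge0.
  apply: (@le_trans _ _ (ka * m `^ p)); last first.
    rewrite ler_pM2l// /m; have [_|_] := leP `|Lclass F| `|H|.
      by rewrite lerDr powR_ge0.
    by rewrite lerDl powR_ge0.
  rewrite -ns_l -powRM// ?mulr_ge0 ?(ltW K'0)//.
  rewrite ge0_ler_powR ?(ltW p0) ?nnegrE ?mulr_ge0 ?(ltW K'0)//.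
  rewrite (le_trans (fK _))// fl lFH (@le_trans _ _ (K' * `|Lclass F + H|))//.
    by rewrite ler_wpM2r// /K' (le_trans (ler_norm _))// lerDl.
  rewrite [2 * K']mulrC -mulrA ler_pM2l// (le_trans (ler_normD _ _))//.
  by rewrite mulr2n mulrDl mul1r lerD// le_max lexx ?orbT.
have NF : `|Lclass F| `^ p <= s * (\int[mu]_t (F t) ^+ 2) + C * fine (mu setT).
  rewrite normp_Lclass; apply: (Rintegral_powR_le_sqr _ _ Fb CP).
    exact: measurable_Lfun.
  exact: integrable_Lfun.
have Q0 : 0 <= \int[mu]_t (F t) ^+ 2 by apply: Rintegral_ge0 => t _; exact: sqr_ge0.
rewrite -/al -size_l -/ns in bnd.
set Q := \int[mu]_t (F t) ^+ 2 in bnd NF Q0.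
have be0 : 0 < (2 * p * del)^-1 by rewrite invr_gt0 !mulr_gt0.
have alQ : al * Q <= 2 * ns.
  by rewrite (le_trans _ bnd)// lerDl mulr_ge0 ?powR_ge0// ltW.
have beH : (2 * p * del)^-1 * `|H| `^ p <= 2 * ns.
  by rewrite (le_trans _ bnd)// lerDr mulr_ge0// ltW.
have kaH : ka * `|H| `^ p <= ns / 4.
  move: beH; rewrite ler_pdivrMl ?mulr_gt0// => /(ler_wpM2l (ltW ka0)).
  move/le_trans; apply; rewrite le_eqVlt; apply/orP; left; apply/eqP.
  by rewrite /del; field; rewrite !gt_eqF.
have kas : ka * (s * Q) <= ns / 4.
  have -> : ka * (s * Q) = al * Q / 8 by rewrite /s; field; rewrite gt_eqF.
  by rewrite ler_pdivrMr//; move: alQ; lra.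
have kaF := ler_wpM2l (ltW ka0) NF.
move: nsF nbig kaH kas kaF; rewrite !mulrDr -!mulrA.
move: (ka * (C * _)) (ka * (s * Q)) (ka * `|H| `^ p) (ka * `|Lclass F| `^ p) (ns).
move=> c1 c2 c3 c4 c5; lra.
Qed.

End necessity.

Theorem theorem1 (R : realType) (p : R) (p1 : (1 <= p%:E)%E) (p2 : p < 2)
    (d : measure_display) (T : measurableType d)
    (nu : {measure set T -> \bar R})
    (X : submodClosed (LspaceType nu p1)) (Xclosed : closed [set` X])
    (G : pointedType) (G1 : card_aleph1 [set: G]) :
  (exists (d' : measure_display) (T' : measurableType d')
          (mu : {finite_measure set T' -> \bar R}),
     embeds_isomorphically (subspace_type X) (LspaceType mu p1))
  <-> ~ embeds_isomorphically (ell p1 G) (subspace_type X).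
Proof.
split=> [[d' [T' [mu [h [_ [K2 hK] _]]]]] [g [_ [K1 gK] _]]|nell].
  (* The composite of two embeddings is bounded below; the absolute value makes the first constant
     nonnegative, so that the bounds can be multiplied. *)
  apply: (no_ell_embedding p2 (f := h \o g) (K := `|K1| * K2) G1.1) => u.
  rewrite (le_trans (gK u))// (@le_trans _ _ (`|K1| * `|g u|))//.
    by rewrite ler_wpM2r// ler_norm.
  by rewrite -mulrA ler_wpM2l.
have [ext|[s sX [C XC]]] := extendable_or_supported p2 Xclosed.
  by case: nell; exact: ell_embeds.
(* On [X] the norm of [Q] is that of the restriction to [supp s], which is equivalent to the norm of
   [X] by [XC]. *)
have [mu [Q QE]] := finite_weight s; exists d, T, mu.
have lQ : linear (fun x : subspace_type X => Q (val x)).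
  by move=> a x y; rewrite -linearP.
have [F FE] := linear_packed lQ.
have FC : exists K : R, forall x, `|F x| <= K * `|x|.
  by exists 1 => x; rewrite FE QE mul1r; exact: restr_norm.
have CF : exists K : R, forall x, `|x| <= K * `|F x|.
  by exists C => x; rewrite FE QE; apply: XC; exact: valP.
exists F; split => //; apply: closed_range => //.
exact: (subspace_complete (@Lspace_complete _ _ _ _ _ _) Xclosed).
Qed.
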